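(* Let $Y$ be a real valued random variable with $\mathbb{E}[Y^2]<\infty$, let $\mathbf{X}=(X_j)_{j\in\mathbb{N}}$ be real valued random variables and let $Z$ take values in $E=\{1,\ldots,K\}$, such that the regular conditional distribution assumption and the mixture model assumption in the context hold. Fix $i\in\mathbb{N}$. Consider data $\mathcal{S}_0$ and $\mathcal{S}$ satisfying the sampling assumption in the context, and let $\widehat\beta_i^{\mathrm{sub}}$ be the substitute adjustment estimator, $\hat\beta_i$ the oracle estimator and $\beta_i$ the target parameter defined in the context. Suppose that $n,m,p\to\infty$ such that $\mathbb{P}(R^{(p)}_{z,v}>\frac1{10})\to0$ for all $z,v\in E$ with $v\neq z$. Then the following hold: (1) $|\widehat\beta_i^{\mathrm{sub}}-\hat\beta_i|\to0$ in probability, and $\widehat\beta_i^{\mathrm{sub}}$ is a consistent estimator of $\beta_i$. (2) If $\frac{\mathrm{sep}(p)}n\to\infty$ and $n\,\mathbb{P}(R^{(p)}_{z,v}>\frac1{10})\to0$ for all $z\neq v$, then $\sqrt n\,|\widehat\beta_i^{\mathrm{sub}}-\hat\beta_i|\to0$ in probability. (3) If $X_j$ conditionally on $Z=z$ is sub-Gaussian with variance factor independent of $j\in\mathbb{N}$ and $z\in E$, and if $\frac{\mathrm{sep}(p)}{\log(n)}\to\infty$ and $n\,\mathbb{P}(R^{(p)}_{z,v}>\frac1{10})\to0$ for all $z\neq v$, then $\sqrt n\,|\widehat\beta_i^{\mathrm{sub}}-\hat\beta_i|\to0$ in probability. In addition, in case (2) as well as in case (3), $\sqrt n(\widehat\beta_i^{\mathrm{sub}}-\beta_i)\to\mathcal{N}(0,w_i^2)$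 in distribution, where the asymptotic variance parameter $w_i^2$ is the same as for the oracle estimator $\hat\beta_i$, i.e. $\sqrt n(\hat\beta_i-\beta_i)\to\mathcal{N}(0,w_i^2)$ in distribution.
   Context: Regular conditional distribution assumption: for each $j\in\mathbb{N}$ a Markov kernel $(P^j_{x,\mathbf{x}})_{(x,\mathbf{x})\in\mathbb{R}\times\mathbb{R}^{\mathbb{N}}}$ on $\mathbb{R}$ is fixed which is a regular conditional distribution of $Y$ given $(X_j,\mathbf{X}_{-j})=(x,\mathbf{x})$, where $\mathbf{X}_{-j}=(X_l)_{l\neq j}$, and $\iint|y|\,P^j_{x,\mathbf{x}}(\mathrm{d}y)P^{-j}(\mathrm{d}\mathbf{x})<\infty$ for all $x\in\mathbb{R}$, with $P^{-j}$ the distribution of $\mathbf{X}_{-j}$. Mixture model assumption: $X_1,X_2,\ldots$ are conditionally independent given $Z=z$ for each $z\in E=\{1,\ldots,K\}$, and (a) the conditional distribution of $X_j$ given $Z=z$ has finite second moment, with $\mu_j(z)=\mathbb{E}[X_j\mid Z=z]$ and $\sigma_j^2(z)=\mathrm{Var}[X_j\mid Z=z]$; (b) $\sum_{j=1}^\infty(\mu_j(z)-\mu_j(v))^2=\infty$ for all $z,v\in E$ with $v\neq z$; (c) there are constants $0<\sigma_{\min}^2\leq\sigma_{\max}^2<\infty$ with $\sigma_{\min}^2\leq\max_{z\in E}\sigma_j^2(z)\leq\sigma_{\max}^2$ for all $j\in\mathbb{N}$; (d) $\mathbb{P}(Z=z)>0$ for all $z\in E$. Sampling assumption: $\mathcal{S}_0=\{\mathbf{x}^0_{1:p,1},\ldots,\mathbf{x}^0_{1:p,m}\}$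 consists of i.i.d. observations of $\mathbf{X}_{1:p}=(X_1,\ldots,X_p)$, $\mathcal{S}=\{(\mathbf{x}_{1:p,1},y_1),\ldots,(\mathbf{x}_{1:p,n},y_n)\}$ consists of i.i.d. observations of $(\mathbf{X}_{1:p},Y)$, and $\mathcal{S}$ is independent of $\mathcal{S}_0$. The unobserved latent variable belonging to the $k$-th observation in $\mathcal{S}$ is $z_k$, so that the $(\mathbf{x}_{1:p,k},z_k,y_k)$ are i.i.d. copies of $(\mathbf{X}_{1:p},Z,Y)$, independent of $\mathcal{S}_0$. Substitute adjustment estimator (for $p\geq i$): from $\mathcal{S}_0$ compute, by any estimation method, estimates $\check\mu_j(z)$ of $\mu_j(z)$ for $j=1,\ldots,p$ and $z\in E$, and set $\check{\boldsymbol\mu}_{1:p}(z)=(\check\mu_j(z))_{j=1,\ldots,p}$. Compute substitutes $\hat z_k=\arg\min_{z\in E}\|\mathbf{x}_{1:p,k}-\check{\boldsymbol\mu}_{1:p}(z)\|_2$, $k=1,\ldots,n$ (ties broken by any fixed measurable rule). With $\hat n(z)=\sum_{k=1}^n1(\hat z_k=z)$, $\hat g(z)=\frac1{\hat n(z)}\sum_{k:\hat z_k=z}y_k$ and $\hat\mu_i(z)=\frac1{\hat n(z)}\sum_{k:\hat z_k=z}x_{i,k}$, $$\widehat\beta_i^{\mathrm{sub}}=\frac{\sum_{k=1}^n(x_{i,k}-\hat\mu_i(\hat z_k))(y_k-\hat g(\hat z_k))}{\sum_{k=1}^n(x_{i,k}-\hat\mu_i(\hat z_k))^2}.$$ The oracle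 estimator $\hat\beta_i$ is given by the same formulas with $\hat z_k$ replaced by the latent $z_k$ throughout. (Values of the estimators when a denominator vanishes may be chosen arbitrarily.) The target parameter is $$\beta_i=\frac{\mathbb{E}[\mathrm{Cov}[X_i,Y\mid Z]]}{\mathbb{E}[\mathrm{Var}[X_i\mid Z]]}.$$ With $\boldsymbol\mu_{1:p}(z)=(\mu_j(z))_{j=1,\ldots,p}$, the relative errors are $$R^{(p)}_{z,v}=\frac{\|\boldsymbol\mu_{1:p}(z)-\check{\boldsymbol\mu}_{1:p}(z)\|_2}{\|\boldsymbol\mu_{1:p}(z)-\boldsymbol\mu_{1:p}(v)\|_2},\quad v\neq z$$ (random variables depending on $\mathcal{S}_0$), and $\mathrm{sep}(p)=\min_{z\neq v}\|\boldsymbol\mu_{1:p}(z)-\boldsymbol\mu_{1:p}(v)\|_2^2$ (presupposing $K\geq2$). ''$X_j$ given $Z=z$ is sub-Gaussian with variance factor $v$'' means $\log\mathbb{E}[e^{\lambda(X_j-\mu_j(z))}\mid Z=z]\leq\frac12\lambda^2v$ for all $\lambda\in\mathbb{R}$. All limits are along a sequence of triples $(n,m,p)$ with all three entries tending to infinity. The constant $w_i^2$ denotes the asymptotic variance parameter of the oracle OLS estimator, characterized by $\sqrt n(\hat\beta_i-\beta_i)\to\mathcal{N}(0,w_i^2)$ in distribution.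
   Formalization: The final claim is stated for every w_i² for which the oracle satisfies √n(β̂_i−β_i)→N(0,w_i²); this oracle limit is a premise, since it can fail under the given assumptions (e.g. Y=|ξ|, X_i=μ_i(Z)+ξ with ξ Student t₃), leaving w_i² undefined. *)

(* Defs.v *)
From HB Require Import structures.
From mathcomp Require Import all_boot all_order all_algebra finmap.
From mathcomp Require Import all_classical all_reals all_analysis.

Set Implicit Arguments.
Unset Strict Implicit.
Unset Printing Implicit Defensive.
Import Order.TTheory GRing.Theory Num.Theory.
Import numFieldNormedType.Exports.
Local Open Scope classical_set_scope.
Local Open Scope ring_scope.

(* The label set E, with every subset measurable. *)
Section discrete_ordinal.
Variable n : nat.
HB.instance Definition _ := isPointed.Build 'I_n.+1 ord0.
HB.instance Definition _ := @isMeasurable.Build default_measure_display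
  'I_n.+1 (@discrete_measurable _) (@discrete_measurable0 _)
  (@discrete_measurableC _) (@discrete_measurableU _).
End discrete_ordinal.

(* R^N with the product sigma-algebra. *)
Definition seq_cylinders (R : realType) : set (set (nat -> R)) :=
  [set C | exists l (A : set R), measurable A /\ C = [set x | A (x l)]].

Definition seqR (R : realType) := g_sigma_algebraType (@seq_cylinders R).
HB.instance Definition _ (R : realType) := Measurable.on (seqR R).

Section independence.
Context d d' (T : measurableType d) (T' : measurableType d') (R : realType).

Definition mutually_independent (P : probability T R) (I : choiceType)
    (U : I -> T -> T') : Prop :=
  forall (J : {fset I}) (A : I -> set T'),
    (forall i, i \in J -> measurable (A i)) ->
    P (\bigcap_(i in [set` J]) (U i @^-1` A i)) =
    (\prod_(i <- J) P (U i @^-1` A i))%E.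

Definition same_law d0 (T0 : measurableType d0) (P : probability T R)
    (U : T -> T') (P0 : probability T0 R) (U0 : T0 -> T') : Prop :=
  forall A : set T', measurable A -> P (U @^-1` A) = P0 (U0 @^-1` A).

Definition iid_copies d0 (T0 : measurableType d0) n (P : probability T R)
    (S : T -> n.-tuple T') (P0 : probability T0 R) (U0 : T0 -> T') : Prop :=
  mutually_independent P (fun k w => tnth (S w) k) /\
  forall k, same_law P (fun w => tnth (S w) k) P0 U0.

End independence.

Definition independent d d1 d2 (T : measurableType d) (T1 : measurableType d1)
    (T2 : measurableType d2) (R : realType) (P : probability T R)
    (U : T -> T1) (V : T -> T2) : Prop :=
  forall A B, measurable A -> measurable B ->
    P (U @^-1` A `&` V @^-1` B) = (P (U @^-1` A) * P (V @^-1` B))%E.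

Section convergence.
Context (R : realType) (d : nat -> measure_display)
  (Om : forall r, measurableType (d r)) (Q : forall r, probability (Om r) R).

Definition cvg_in_probability (U : forall r, Om r -> R) (l : R) : Prop :=
  forall e : R, 0 < e ->
    Q r [set w | e < `|U r w - l|] @[r --> \oo] --> 0%E.

Definition cvg_in_distribution (U : forall r, Om r -> R)
    (nu : probability (measurableTypeR R) R) : Prop :=
  forall f : R -> R, continuous f -> (exists M : R, forall x : R, `|f x| <= M) ->
    ('E_(Q r)[f \o U r] @[r --> \oo] --> \int[nu]_x (f x)%:E)%E.

End convergence.

(* N(0, s ^ 2); [normal_prob 0 0] is not the point mass at 0, hence the case
   distinction. *)
Definition centered_normal (R : realType) (s : R) :
    probability (measurableTypeR R) R :=
  if s == 0 then @dirac _ (measurableTypeR R) (0 : R) R :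
    probability (measurableTypeR R) R
  else normal_prob 0 s.

Section population.
Context d (Om : measurableType d) (R : realType) (P : probability Om R).
Context (K : nat) (X : nat -> {RV P >-> R}) (Y : {RV P >-> R})
  (Z : {RV P >-> 'I_K.+1}).

(* X_{-j}, whose l-th coordinate is the l-th element of (X_l)_{l <> j}. *)
Definition omit (j : nat) (w : Om) : seqR R := fun l => X (bump j l) w.

Lemma measurable_omit j : measurable_fun [set: Om] (omit j).
Proof.
apply: (@measurability _ _ Om (seqR R) _ _ (@seq_cylinders R)) => // _ [C [l [A [mA ->]] <-]].
exact: (measurable_funP (X (bump j l)) measurableT _ mA).
Qed.

HB.instance Definition _ j :=
  isMeasurableFun.Build _ _ _ _ (omit j) (measurable_omit j).

Definition regular_conditional_distributions
    (Pk : forall j : nat, R.-pker (R * seqR R)%type ~> R) : Prop :=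
  forall j,
    (forall (C : set (R * seqR R)) (B : set R), measurable C -> measurable B ->
      P ((fun w => (X j w, omit j w)) @^-1` C `&` Y @^-1` B) =
      (\int[P]_(w in (fun w => (X j w, omit j w)) @^-1` C)
         Pk j (X j w, omit j w) B)%E) /\
    forall x : R,
      (\int[distribution P (omit j)]_xx \int[Pk j (x, xx)]_y `|y|%:E < +oo)%E.

Lemma measurable_label z : measurable (Z @^-1` [set z]).
Proof. by rewrite -[_ @^-1` _]setTI; exact: measurable_funP. Qed.

(* P( . | Z = z); the second argument of [mnormalize] is the value taken
   when P(Z = z) = 0. *)
Definition cond_prob (z : 'I_K.+1) : probability Om R :=
  mnormalize (mrestr P (measurable_label z)) P.

Definition cmean (j : nat) (z : 'I_K.+1) : R :=
  fine ('E_(cond_prob z)[X j])%E.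

Definition cvar (j : nat) (z : 'I_K.+1) : R :=
  fine ('V_(cond_prob z)[X j])%E.

Definition mixture_model : Prop :=
  [/\ forall z, mutually_independent (cond_prob z) (fun j => X j : Om -> R),
      forall j z, ('E_(cond_prob z)[(fun w => X j w ^+ 2)%R] < +oo)%E,
      forall z v, v != z ->
        (\sum_(0 <= j <oo) ((cmean j z - cmean j v) ^+ 2)%:E = +oo)%E,
      exists smin2 smax2 : R, [/\ 0 < smin2, smin2 <= smax2 &
        forall j, smin2 <= \big[Num.max/0]_z cvar j z <= smax2] &
      forall z, (0 < P (Z @^-1` [set z]))%E].

Definition subgaussian (v : R) (j : nat) (z : 'I_K.+1) : Prop :=
  forall l : R,
    (lne 'E_(cond_prob z)[(fun w => expR (l * (X j w - cmean j z)))%R] <=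
     (2^-1 * l ^+ 2 * v)%:E)%E.

(* E[Cov[X_i, Y | Z]] / E[Var[X_i | Z]] *)
Definition target (i : nat) : R :=
  fine ('E_P[fun w => fine (covariance (cond_prob (Z w)) (X i) Y)])%E /
  fine ('E_P[fun w => cvar i (Z w)])%E.

Definition Xvec (p : nat) (w : Om) : p.-tuple R := [tuple X j w | j < p].

Definition muvec (p : nat) (z : 'I_K.+1) : p.-tuple R :=
  [tuple cmean j z | j < p].

End population.

Definition l2dist (R : realType) (p : nat) (u v : p.-tuple R) : R :=
  Num.sqrt (\sum_(j < p) (tnth u j - tnth v j) ^+ 2).

(* The minimum over pairs z <> v; it is +oo when there is a single label. *)
Definition sep d (Om : measurableType d) (R : realType) (P : probability Om R)
    (K : nat) (X : nat -> {RV P >-> R}) (Z : {RV P >-> 'I_K.+1})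
    (p : nat) : \bar R :=
  \big[Order.min/+oo%E]_(zv : 'I_K.+1 * 'I_K.+1 | zv.1 != zv.2)
     (l2dist (muvec X Z p zv.1) (muvec X Z p zv.2) ^+ 2)%:E.

Section adjusted_regression.
Context (R : realType) (K n : nat).
Implicit Types (x y : 'I_n -> R) (c : 'I_n -> 'I_K.+1).

Definition label_mean c (u : 'I_n -> R) (z : 'I_K.+1) : R :=
  (#|[set k | c k == z]%SET|%:R)^-1 * \sum_(k < n | c k == z) u k.

Definition within_cov c x y : R :=
  \sum_(k < n) (x k - label_mean c x (c k)) * (y k - label_mean c y (c k)).

Definition within_var c x : R :=
  \sum_(k < n) (x k - label_mean c x (c k)) ^+ 2.

End adjusted_regression.

Section sample.
Context (R : realType) (K p : nat).

(* One observation (x_{1:p}, z, y), latent label included. *)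
Definition observation := (p.-tuple R * 'I_K.+1 * R)%type.

Context (Om : Type) (n : nat).

Definition obs_x (S : Om -> n.-tuple observation) (w : Om) (k : 'I_n) :=
  (tnth (S w) k).1.1.
Definition obs_z (S : Om -> n.-tuple observation) (w : Om) (k : 'I_n) :=
  (tnth (S w) k).1.2.
Definition obs_y (S : Om -> n.-tuple observation) (w : Om) (k : 'I_n) :=
  (tnth (S w) k).2.

(* [b] is unconstrained where the denominator vanishes. *)
Definition is_adjustment_estimator (i : 'I_p) (S : Om -> n.-tuple observation)
    (c : Om -> 'I_n -> 'I_K.+1) (b : Om -> R) : Prop :=
  forall w, let x k := tnth (obs_x S w k) i in
    within_var (c w) x != 0 ->
    b w = within_cov (c w) x (obs_y S w) / within_var (c w) x.

Definition is_nearest_rule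
    (rule : p.-tuple R * K.+1.-tuple (p.-tuple R) -> 'I_K.+1) : Prop :=
  forall x mu z, l2dist x (tnth mu (rule (x, mu))) <= l2dist x (tnth mu z).

End sample.

Definition sampling d0 (Om0 : measurableType d0) (R : realType)
    (P : probability Om0 R) (K : nat) (X : nat -> {RV P >-> R})
    (Y : {RV P >-> R}) (Z : {RV P >-> 'I_K.+1})
    d (Om : measurableType d) (Q : probability Om R) (n m p : nat)
    (S0 : {RV Q >-> m.-tuple (p.-tuple R)})
    (S : {RV Q >-> n.-tuple (observation R K p)}) : Prop :=
  [/\ iid_copies Q S0 P (@Xvec _ _ _ P X p),
      iid_copies Q S P (fun w => (Xvec X p w, Z w, Y w)) &
      independent Q S S0].

(* The substitutes: nearest estimated center, ties resolved by [rule]. *)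
Definition substitutes (R : realType) (K n m p : nat)
    (rule : p.-tuple R * K.+1.-tuple (p.-tuple R) -> 'I_K.+1)
    (mucheck : m.-tuple (p.-tuple R) -> K.+1.-tuple (p.-tuple R))
    (Om : Type) (S0 : Om -> m.-tuple (p.-tuple R))
    (S : Om -> n.-tuple (observation R K p)) (w : Om) (k : 'I_n) : 'I_K.+1 :=
  rule (obs_x S w k, mucheck (S0 w)).

Definition rel_error d0 (Om0 : measurableType d0) (R : realType)
    (P : probability Om0 R) (K : nat) (X : nat -> {RV P >-> R})
    (Z : {RV P >-> 'I_K.+1}) (p : nat) (mu : K.+1.-tuple (p.-tuple R))
    (z v : 'I_K.+1) : R :=
  l2dist (muvec X Z p z) (tnth mu z) /
  l2dist (muvec X Z p z) (muvec X Z p v).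

(* Main.v *)
Require Import Defs.
From HB Require Import structures.
From mathcomp Require Import all_boot all_order all_algebra finmap.
From mathcomp Require Import all_classical all_reals all_analysis.
From mathcomp Require Import measurable_realfun.
From mathcomp Require Import ring lra.

(** Why the theorem holds.

    Misclassification. If an observation with latent label [z] gets the
    substitute [v], then its covariates are nearer to the estimated center of
    [v] than to that of [z]. When the estimated centers have relative errors at
    most 1/10, expanding the squares shows that a linear combination of the
    centered covariates is below [- 2 / 5 * D ^ 2], where [D] is the distance
    between the true centers, and that its coefficients have squared length at
    most [36 / 25 * D ^ 2] ([nearest_wrong_center]). Given the label the
    covariates are independent, so this has probability at most a constant times
    [D ^ -2] by Chebyshev's inequality, and at most [exp (- C * D ^ 2)] for
    some [C > 0] by Chernoff's in the sub-Gaussian case ([chebyshev_tail],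
    [subgaussian_tail]). The estimated centers are random, but independent of
    the observation, so they may be frozen ([independent_section_bound]).
    Summing over pairs of labels and adding the probabilities of large relative
    errors gives a bound that is uniform over the sample
    ([misclassification_boundP]); it tends to zero because the centers drift
    apart ([centers_diverge]).

    Consistency. Divided by the sample size, numerator and denominator of
    either estimator are continuous functions of averages of [u x_k y_k] over
    the sample and over the observations with a given label
    ([within_cov_class_mean]). For the latent labels these averages converge by
    a weak law of large numbers for arrays ([weak_law_of_large_numbers]).
    Passing to the substitutes changes them at most by the average of [`|u|]
    over the misclassified observations, which tends to zero in L1 by uniform
    integrability ([misclassified_mean_whp]). The limits are the mean
    conditional covariance and variance ([within_covarianceE]), so both
    estimators converge to the target ([estimator_consistent]).

    Rate. Under either separation rate the misclassification bound tends to zero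
    even after multiplication by the sample size [n]. By a union bound all substitutes are then
    correct with probability tending to one ([all_labels_recovered]), and on
    that event the two estimators coincide. Hence their difference times the
    square root of [n] tends to zero, and a limit law of one is a limit law of
    the other ([cvg_in_distribution_whp]). *)

Set Implicit Arguments.
Unset Strict Implicit.
Unset Printing Implicit Defensive.
Import Order.TTheory GRing.Theory Num.Theory.
Import numFieldNormedType.Exports.
Local Open Scope classical_set_scope.
Local Open Scope ring_scope.

(** * Measurability and limits *)

Section measurable_tools.
Context d (T : measurableType d) (R : realType).
Implicit Types (f g : T -> R).

Lemma measurable_set_ltr f g : measurable_fun setT f -> measurable_fun setT g ->
  measurable [set w | f w < g w].
Proof.
move=> mf mg; rewrite -[X in measurable X]setTI.
by have := measurable_fun_ltr mf mg measurableT (I : measurable [set true]);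
rewrite preimage_true.
Qed.

Lemma measurable_set_ler f g : measurable_fun setT f -> measurable_fun setT g ->
  measurable [set w | f w <= g w].
Proof.
move=> mf mg; rewrite -[X in measurable X]setTI.
by have := measurable_fun_ler mf mg measurableT (I : measurable [set true]);
rewrite preimage_true.
Qed.

Lemma measurable_exceedance f (M : R) : measurable_fun setT f ->
  measurable_fun setT (fun x => (M < f x)%R%:R : R).
Proof.
move=> mf; rewrite (_ : (fun x => _) = \1_[set x | M < f x]).
  by apply: measurable_indic; exact: measurable_set_ltr.
apply/funext => x; rewrite indicE; congr (nat_of_bool _)%:R.
by apply/idP/idP; rewrite inE.
Qed.

Lemma markov_ge0 (P : probability T R) f (a : R) : measurable_fun setT f ->
  (forall w, 0 <= f w) -> 0 < a ->
  (P [set w | (a <= f w)%R] <= a^-1%:E * \int[P]_w (f w)%:E)%E.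
Proof.
move=> mf f0 a0; rewrite lee_pdivlMl//.
have mf' : measurable_fun setT (EFin \o f) by exact/measurable_EFinP.
have := le_integral_abse P measurableT mf' a0; rewrite setTI.
rewrite (_ : [set x | _] = [set w | a <= f w]); last first.
  by apply/seteqP; split=> w /=; rewrite lee_fin ger0_norm.
by under eq_integral do rewrite /= ger0_norm//.
Qed.

End measurable_tools.

Lemma measure_union_bound d (T : measurableType d) (R : realType)
    (P : probability T R) (I : finType) (p : pred I) (F : I -> set T)
    (b : I -> \bar R) (A : set T) :
  measurable A -> (forall i, measurable (F i)) ->
  (forall w, A w -> exists2 i, p i & F i w) ->
  (forall i, p i -> (P (F i) <= b i)%E) ->
  (P A <= \sum_(i | p i) b i)%E.
Proof.
move=> mA mF AF Fb.
apply: (@le_trans _ _ (\sum_(i | p i) P (F i))%E); last exact: lee_sum.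
apply: (@le_trans _ _ (P (\big[setU/set0]_(i | p i) F i))).
  apply: le_measure; rewrite ?inE//; first exact: bigsetU_measurable.
  by move=> w /AF[i pi Fi]; rewrite (bigD1 i)//=; left.
suff [] : measurable (\big[setU/set0]_(i | p i) F i) /\
    (P (\big[setU/set0]_(i | p i) F i) <= \sum_(i | p i) P (F i))%E by [].
apply: (big_rec2 (fun B x => measurable B /\ (P B <= x)%E)) => [|i B x pi [mB IH]].
  by rewrite measure0.
split; first exact: measurableU.
by apply: (le_trans (measureU2 _ _ _)) => //; rewrite leeD2l.
Qed.

Lemma cvge0_sup (R : realType) (T : Type) (F : set_system T) (f g : T -> \bar R) : Filter F ->
  (\forall x \near F, (0 <= f x <= g x)%E) -> g @ F --> 0%E -> f @ F --> 0%E.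
Proof. by move=> FF fg g0; apply: (squeeze_cvge fg) => //; exact: cvg_cst. Qed.

Lemma cvge0_near_lt (R : realType) (T : Type) (F : set_system T) {FF : Filter F}
    (f : T -> \bar R) (e : R) :
  f @ F --> 0%E -> 0 < e -> \forall x \near F, (f x < e%:E)%E.
Proof.
move=> /fine_cvgP[ff /cvgrPdist_lt f0] e0.
apply: filterS2 ff (f0 _ e0) => x fx /=; rewrite sub0r normrN.
by move=> /(le_lt_trans (ler_norm _)); rewrite -lte_fin fineK.
Qed.

Lemma cvge0P (R : realType) (T : Type) (F : set_system T) {FF : Filter F}
    (f : T -> \bar R) :
  (forall x, (0 <= f x)%E) ->
  (forall e : R, 0 < e -> \forall x \near F, (f x <= e%:E)%E) -> f @ F --> 0%E.
Proof.
move=> f0 fe; apply/fine_cvgP; split.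
  by apply: filterS (fe 1 ltr01) => x fx; rewrite ge0_fin_numE// (le_lt_trans fx) ?ltry.
apply/cvgrPdist_le => e e0; apply: filterS (fe e e0) => x fx /=.
rewrite sub0r normrN ger0_norm ?fine_ge0// -lee_fin fineK//.
by rewrite ge0_fin_numE// (le_lt_trans fx) ?ltry.
Qed.

(** * Events of probability tending to one *)

Section whp.
Context (R : realType) (d : nat -> measure_display)
  (Om : forall r, measurableType (d r)) (Q : forall r, probability (Om r) R).

(** The sample points of all the probability spaces are gathered in one type, so
    that convergence in probability along a sequence of spaces becomes
    convergence along a filter, to which the calculus of limits (sums,
    products, inverses) applies. A set of the filter need not
    be measurable, hence the measurable majorant of its complement. *)
Definition whp : set_system {r : nat & Om r} :=
  [set A | exists2 B : forall r, set (Om r), (forall r, measurable (B r)) /\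
    Q r (B r) @[r --> \oo] --> 0%E &
    forall r w, ~ A (existT _ r w) -> B r w].

#[global] Instance whp_filter : Filter whp.
Proof.
split.
- exists (fun r => set0); last by move=> r w; apply; exact: I.
  split; first by move=> r; exact: measurable0.
  rewrite (_ : (fun r => _) = cst 0%E); first exact: cvg_cst.
  by apply/funext => r; rewrite measure0.
- move=> A A' [B [mB B0] AB] [B' [mB' B'0] AB'].
  exists (fun r => B r `|` B' r).
    split=> [r|]; first exact: measurableU.
    apply: (@squeeze_cvge _ _ _ _ (cst 0%E) _ (fun r => Q r (B r) + Q r (B' r))%E).
    + apply: nearW => r; rewrite measure_ge0 /=; exact: measureU2.
    + exact: cvg_cst.
    + by rewrite -[X in _ --> X]adde0; apply: cvgeD.
  move=> r w /= /not_andP[?|?]; [left; exact: AB|right; exact: AB'].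
- move=> A A' sA [B [mB B0] AB]; exists B => // r w nA'.
  by apply: AB => nA; apply: nA'; exact: sA.
Qed.

Lemma whp_large (A : set nat) : (\forall r \near \oo, A r) ->
  \forall x \near whp, A (projT1 x).
Proof.
move=> nA; exists (fun r => [set w | ~ A r]) => //=; split.
  move=> r; case: (pselect (A r)) => Ar.
    by rewrite (_ : [set _ | _] = set0) // -subset0 => w /=.
  by rewrite (_ : [set _ | _] = setT) // -subTset => w /=.
apply: cvg_near_cst; apply: filterS nA => r Ar.
by rewrite (_ : [set _ | _] = set0) ?measure0 // -subset0 => w /=.
Qed.

Definition onS (T : Type) (U : forall r, Om r -> T) (x : {r : nat & Om r}) : T :=
  U (projT1 x) (projT2 x).

Lemma cvg_in_probability_whp (U : forall r, Om r -> R) (l : R) :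
  (forall r, measurable_fun setT (U r)) ->
  onS U @ whp --> l -> cvg_in_probability Q U l.
Proof.
move=> mU /cvgrPdist_le Ul e e0.
have [B [mB B0] UB] := Ul e e0.
apply: (squeeze_cvge _ (cvg_cst 0%E) B0).
apply: nearW => r; rewrite measure_ge0 /= le_measure// ?inE//.
  apply: measurable_set_ltr => //; apply: measurableT_comp => //.
  by apply: measurable_funB => //; exact: measurable_cst.
move=> w /= eU; apply: UB => /=; rewrite /onS/= distrC; apply/negP.
by rewrite -ltNge.
Qed.

Lemma whp_subset (A : forall r, set (Om r)) :
  (forall r, measurable (A r)) -> Q r (~` A r) @[r --> \oo] --> 0%E ->
  \forall x \near whp, A (projT1 x) (projT2 x).
Proof.
by move=> mA A0; exists (fun r => ~` A r) => //; split=> // r; exact: measurableC.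
Qed.

Lemma cvg_L1_whp (V : forall r, Om r -> R) :
  (forall r, measurable_fun setT (V r)) ->
  (\int[Q r]_w `|V r w|%:E)%E @[r --> \oo] --> 0%E ->
  onS V @ whp --> (0:R).
Proof.
move=> mV V0; apply/cvgrPdist_lt => e e0.
pose A r := [set w | `|V r w| < e].
have mnV r : measurable_fun setT (fun w => `|V r w|) by exact: measurableT_comp.
have : \forall x \near whp, A (projT1 x) (projT2 x).
  apply: whp_subset => [r|]; first exact: measurable_set_ltr.
  apply: (@cvge0_sup _ _ _ _ (fun r => (e^-1%:E * \int[Q r]_w `|V r w|%:E)%E)).
  - apply: nearW => r; rewrite measure_ge0/=.
    rewrite (_ : ~` A r = [set w | e <= `|V r w|]); first exact: markov_ge0.
    by apply/seteqP; split=> w; rewrite /A/= leNgt => /negP.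
  - by rewrite -[X in _ --> X](mule0 e^-1%:E); apply: cvgeZl.
by apply: filterS => -[r w]; rewrite /A /onS/= sub0r normrN.
Qed.

(** Against a test function bounded by [M] the two expectations differ by at most
    [2 M] times the probability of the exceptional event. *)
Lemma cvg_in_distribution_whp (U V : forall r, Om r -> R)
    (nu : probability (measurableTypeR R) R) :
  (forall r, measurable_fun setT (U r)) ->
  (forall r, measurable_fun setT (V r)) ->
  (\forall x \near whp, onS U x = onS V x) ->
  cvg_in_distribution Q U nu -> cvg_in_distribution Q V nu.
Proof.
move=> mU mV [B [mB B0] UB] Unu f cf [M fM].
have mf : measurable_fun [set: R] f by exact: continuous_measurable_fun.
have bint W : (forall r, measurable_fun setT (W r)) ->
    forall r, (Q r).-integrable setT (EFin \o (f \o W r)).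
  move=> mW r; apply: measurable_bounded_integrable => //.
  - by rewrite -ge0_fin_numE ?fin_num_measure.
  - exact: measurableT_comp.
  - exists M; split; first exact: num_real.
    by move=> x Mx y _ /=; rewrite (le_trans (fM _))// ltW.
have Mge0 : 0 <= M by rewrite (le_trans _ (fM 0)).
have diff : (('E_(Q r)[f \o V r] - 'E_(Q r)[f \o U r]) @[r --> \oo] --> 0)%E.
  apply/cvg_abse0P; apply: (@cvge0_sup _ _ _ _ (fun r => ((2 * M)%:E * Q r (B r))%E)).
    apply: nearW => r; rewrite abse_ge0/=.
    rewrite unlock -integralB_EFin//; try exact: bint.
    apply: (le_trans (le_abse_integral _ _ _)) => //.
      by apply: measurable_int; apply: integrableB => //; exact: bint.
    rewrite -integral_cst// [leRHS]integral_mkcond; apply: ge0_le_integral => //.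
    - apply: measurableT_comp => //.
      by apply: measurable_int; apply: integrableB => //; exact: bint.
    - by apply/(measurable_restrictT _ (mB r)); exact: measurable_cst.
    - move=> w _; rewrite patchE; case: ifPn => [_|].
        rewrite /cst -EFinB/= lee_fin (le_trans (ler_normB _ _))//.
        by rewrite mulrDl mul1r lerD.
      rewrite notin_setE => nB /=.
      have -> : V r w = U r w by apply: contrapT => UV; apply/nB/UB; rewrite /onS/=; exact: nesym.
      by rewrite /= subrr normr0.
  rewrite -[X in _ --> X](mule0 (2 * M)%:E); exact: cvgeZl.
have -> : (fun r => 'E_(Q r)[f \o V r])%E =
  (fun r => 'E_(Q r)[f \o U r] + ('E_(Q r)[f \o V r] - 'E_(Q r)[f \o U r]))%E.
  apply/funext => r; rewrite addeC subeK// unlock.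
  by apply: integrable_fin_num => //; exact: bint.
rewrite -[X in _ --> X]adde0; apply: cvgeD; last exact: diff.
  by rewrite fin_num_adde_defl.
by apply: Unu => //; exists M.
Qed.

End whp.

(** * Integrals under image laws *)

Section density.
Local Open Scope ereal_scope.
Context d1 d2 (T1 : measurableType d1) (T2 : measurableType d2) (R : realType).
Variables (mu : {measure set T1 -> \bar R}) (nu : {measure set T2 -> \bar R}).
Variables (V : T1 -> T2) (F : T1 -> R).
Hypotheses (mV : measurable_fun setT V) (mF : measurable_fun setT F)
  (F0 : forall x, (0 <= F x)%R).
Hypothesis nuE : forall A, measurable A -> nu A = \int[mu]_(x in V @^-1` A) (F x)%:E.

Import HBNNSimple.

Let nuE_indic A : measurable A ->
  nu A = \int[mu]_x ((F x)%:E * (\1_A (V x))%:E).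
Proof.
move=> mA; rewrite nuE// integral_mkcond; apply: eq_integral => x _.
rewrite patchE indicE; case: ifPn => [|].
  by rewrite inE/= => Ax; rewrite mem_set// mule1.
by rewrite notin_setE /= => Ax; rewrite memNset// mule0.
Qed.

Let density_nnsfun (h : {nnsfun T2 >-> R}) :
  \int[nu]_y (h y)%:E = \int[mu]_x ((F x)%:E * (h (V x))%:E).
Proof.
under [LHS]eq_integral do rewrite fimfunE -fsumEFin//.
rewrite [LHS]ge0_integral_fsum//; last 2 first.
  - by move=> r; exact/measurable_EFinP/measurableT_comp.
  - by move=> n x _; rewrite EFinM nnfun_muleindic_ge0.
under [RHS]eq_integral.
  move=> x xD; rewrite fimfunE -fsumEFin// ge0_mule_fsumr; last first.
    by move=> r; rewrite EFinM nnfun_muleindic_ge0.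
  over.
have mi r : measurable_fun setT (fun x => (\1_(h @^-1` [set r]) (V x))%:E : \bar R).
  by apply/measurable_EFinP; apply: measurableT_comp.
rewrite [RHS]ge0_integral_fsum//; last 2 first.
  - move=> r; apply: emeasurable_funM; apply/measurable_EFinP => //.
    by apply: measurable_funM => //; apply/measurable_EFinP; exact: mi.
  - move=> n x _; rewrite EFinM mule_ge0//; first by rewrite lee_fin.
    exact: nnfun_muleindic_ge0.
apply: eq_fsbigr => r _; rewrite integralZl_indic_nnsfun//= integral_indic// setIT.
rewrite nuE_indic//; have [r0|r0] := leP 0%R r.
  rewrite -ge0_integralZl//.
  - by apply: eq_integral => x _; rewrite EFinM muleCA.
  - by apply: emeasurable_funM; [exact/measurable_EFinP|exact: mi].
  - by move=> x _; rewrite mule_ge0// lee_fin.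
have -> : h @^-1` [set r] = set0 by exact: preimage_nnfun0.
rewrite !integral0_eq ?mule0//.
  by move=> x _; rewrite indic0 mulr0 mule0.
by move=> x _; rewrite indic0 mule0.
Qed.

(** One change of variables serves three purposes: equality in law (with
    [F = 1]), conditioning on the label (with [V] the identity and [F] the
    normalized indicator of the label) and independence of [F] and [V]. *)
Lemma ge0_integral_density (f : T2 -> \bar R) : measurable_fun setT f ->
  (forall y, 0 <= f y) -> \int[nu]_y f y = \int[mu]_x ((F x)%:E * f (V x)).
Proof.
move=> mf f0; pose f_ := nnsfun_approx measurableT mf.
have f_f y : ((f_ n y)%:E @[n --> \oo] --> f y).
  exact: cvg_nnsfun_approx.
have mf_ n : measurable_fun setT (fun y => (f_ n y)%:E) by exact/measurable_EFinP.
have f_nd y n m : (n <= m)%N -> (f_ n y)%:E <= (f_ m y)%:E.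
  by move=> nm; rewrite lee_fin; exact/lefP/nd_nnsfun_approx.
have mEF : measurable_fun setT (EFin \o F) by exact/measurable_EFinP.
have -> : \int[nu]_y f y = limn (fun n => \int[nu]_y (f_ n y)%:E).
  rewrite -monotone_convergence//=.
  - by apply: eq_integral => y _; apply/esym/cvg_lim => //; exact: f_f.
  - by move=> n y _; rewrite lee_fin.
  - by move=> y _ n m; exact: f_nd.
have -> : \int[mu]_x ((F x)%:E * f (V x)) =
    limn (fun n => \int[mu]_x ((F x)%:E * (f_ n (V x))%:E)).
  rewrite -monotone_convergence//=.
  - apply: eq_integral => x _; apply/esym/cvg_lim => //.
    by apply: cvgeZl => //; exact: f_f.
  - by move=> n; apply: emeasurable_funM => //; exact: (measurableT_comp (mf_ n)).
  - by move=> n x _; rewrite mule_ge0// ?lee_fin.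
  - by move=> x _ n m nm; apply: lee_wpmul2l; rewrite ?lee_fin//; exact: f_nd.
by congr (limn _); apply/funext => n; exact: density_nnsfun.
Qed.

End density.

Section laws.
Local Open Scope ereal_scope.
Context d (T : measurableType d) (R : realType).

(** How independence, which speaks of events, passes to expectations: there [F]
    is the first factor and [c] its mean. *)
Lemma ge0_integral_scaled_law d' (T' : measurableType d') (P : probability T R)
    (V : T -> T') (F : T -> R) (c : R) :
  measurable_fun setT V -> measurable_fun setT F -> (forall x, (0 <= F x)%R) ->
  (0 <= c)%R ->
  (forall A, measurable A ->
     \int[P]_(x in V @^-1` A) (F x)%:E = c%:E * P (V @^-1` A)) ->
  forall f : T' -> \bar R, measurable_fun setT f -> (forall y, 0 <= f y) ->
  \int[P]_x ((F x)%:E * f (V x)) = c%:E * \int[P]_x f (V x).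
Proof.
move=> mV mF F0 c0 FE f mf f0.
pose Vm : {mfun T >-> T'} := HB.pack V (isMeasurableFun.Build _ _ _ _ V mV).
pose nu := mscale (NngNum c0) (distribution P (Vm : {RV P >-> T'})).
have <- := @ge0_integral_density _ _ _ _ _ P nu V F mV mF F0 _ f mf f0.
  by rewrite ge0_integral_mscale// ge0_integral_distribution.
by move=> A mA; rewrite FE.
Qed.

Lemma ge0_integral_same_law d0 (T0 : measurableType d0) d' (T' : measurableType d')
   (Q : probability T R) (U : T -> T') (P : probability T0 R) (U0 : T0 -> T')
   (f : T' -> \bar R) :
  measurable_fun setT U -> measurable_fun setT U0 -> same_law Q U P U0 ->
  measurable_fun setT f -> (forall y, 0 <= f y) ->
  \int[Q]_x f (U x) = \int[P]_x f (U0 x).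
Proof.
move=> mU mU0 UU0 mf f0.
pose Um : {mfun T0 >-> T'} := HB.pack U0 (isMeasurableFun.Build _ _ _ _ U0 mU0).
pose nu := distribution P (Um : {RV P >-> T'}).
have H := @ge0_integral_density _ _ _ _ _ Q nu U (cst 1%R) mU
  (@measurable_cst _ _ _ _ setT (1%R : R)) (fun=> ler01) _ f mf f0.
rewrite ge0_integral_distribution// in H.
transitivity (\int[P]_x (f \o Um) x) => //; rewrite H.
  by apply: eq_integral => x _; rewrite mul1e.
move=> A mA; transitivity (Q (U @^-1` A)); first exact/esym/UU0.
rewrite -[LHS]mul1e -integral_cst//.
by rewrite -[X in measurable X]setTI; exact: mU.
Qed.

Lemma same_law_comp d0 (T0 : measurableType d0) d1 (T1 : measurableType d1)
   d2 (T2 : measurableType d2)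
   (Q : probability T R) (U : T -> T1) (P : probability T0 R) (U0 : T0 -> T1)
   (h : T1 -> T2) : measurable_fun setT h ->
  same_law Q U P U0 -> same_law Q (h \o U) P (h \o U0).
Proof.
move=> mh UU0 A mA; apply: (UU0 (h @^-1` A)).
by rewrite -[X in measurable X]setTI; exact: mh.
Qed.

Lemma independent_comp d1 (T1 : measurableType d1) d2 (T2 : measurableType d2)
   d3 (T3 : measurableType d3) d4 (T4 : measurableType d4) (P : probability T R)
   (U : T -> T1) (V : T -> T2) (f : T1 -> T3) (g : T2 -> T4) :
  measurable_fun setT f -> measurable_fun setT g ->
  independent P U V -> independent P (f \o U) (g \o V).
Proof.
move=> mf mg UV A B mA mB; apply: (UV (f @^-1` A) (g @^-1` B)).
  by rewrite -[X in measurable X]setTI; exact: mf.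
by rewrite -[X in measurable X]setTI; exact: mg.
Qed.

Section real_laws.
Context d0 (T0 : measurableType d0) (Q : probability T R) (P : probability T0 R).
Variables (U : T -> R) (U0 : T0 -> R).
Hypotheses (mU : measurable_fun setT U) (mU0 : measurable_fun setT U0)
  (UU0 : same_law Q U P U0).

Lemma same_law_integrable :
  P.-integrable setT (EFin \o U0) -> Q.-integrable setT (EFin \o U).
Proof.
move=> /integrableP[_ U0oo]; apply/integrableP; split; first exact/measurable_EFinP.
rewrite (_ : \int[Q]_x _ = \int[P]_x `|(EFin \o U0) x|)//.
apply: (ge0_integral_same_law (f := fun y : R => `|y|%R%:E) mU mU0 UU0) => //.
by apply/measurable_EFinP; exact: normr_measurable.
Qed.

Lemma same_law_Rintegral : (\int[Q]_x U x = \int[P]_x U0 x)%R.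
Proof.
rewrite /Rintegral integralE [in RHS]integralE; congr (fine (_ - _));
  under eq_integral do rewrite (funeposE,funenegE) -EFin_max;
  under [RHS]eq_integral do rewrite (funeposE,funenegE) -EFin_max.
  apply: (ge0_integral_same_law (f := fun y : R => (Num.max y 0)%R%:E) mU mU0 UU0).
    by apply/measurable_EFinP; apply: measurable_maxr.
  by move=> y; rewrite lee_fin le_max lexx orbT.
apply: (ge0_integral_same_law (f := fun y : R => (Num.max (- y) 0)%R%:E) mU mU0 UU0).
  by apply/measurable_EFinP; apply: measurable_maxr.
by move=> y; rewrite lee_fin le_max lexx orbT.
Qed.

End real_laws.

End laws.

(** * Products of independent variables *)

Section products.
Local Open Scope ereal_scope.
Context d (T : measurableType d) (R : realType).
Variable P : probability T R.

(** The product rule is extended from events to expectations one factor at a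
    time: the indicator of an event of [V] is kept while [U] is integrated. *)
Lemma ge0_integral_indepM (U V : T -> R) :
  measurable_fun setT U -> measurable_fun setT V ->
  (forall x, (0 <= U x)%R) -> (forall x, (0 <= V x)%R) ->
  P.-integrable setT (EFin \o U) -> independent P U V ->
  \int[P]_x (U x * V x)%:E = (\int[P]_x U x)%:E * \int[P]_x (V x)%:E.
Proof.
move=> mU mV U0 V0 iU UV.
have mn : measurable_fun setT (fun y : R => `|y|%:E).
  by apply/measurable_EFinP.
have UVA A : measurable A ->
    \int[P]_(x in V @^-1` A) (U x)%:E = (\int[P]_x U x)%:E * P (V @^-1` A).
  move=> mA.
  have mVA : measurable (V @^-1` A) by rewrite -[X in measurable X]setTI; exact: mV.
  have fVA : P (V @^-1` A) \is a fin_num by rewrite fin_num_measure.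
  have H B : measurable B -> \int[P]_(x in U @^-1` B) (\1_(V @^-1` A) x)%:E =
      (fine (P (V @^-1` A)))%:E * P (U @^-1` B).
    move=> mB; have mUB : measurable (U @^-1` B).
      by rewrite -[X in measurable X]setTI; exact: mU.
    by rewrite integral_indic// fineK// muleC -(UV _ _ mB mA) setIC.
  have m1 : measurable_fun setT (\1_(V @^-1` A) : T -> R) by exact: measurable_indic.
  have := ge0_integral_scaled_law mU m1 (fun x => ler0n _ _) (fine_ge0 (measure_ge0 P _)) H mn (fun=> normr_ge0 _).
  rewrite fineK// fineK ?integrable_fin_num//.
  under [X in _ = _ * X -> _]eq_integral do rewrite ger0_norm//.
  rewrite muleC => <- //.
  rewrite integral_mkcond; apply: eq_integral => x _.
  rewrite patchE indicE; case: ifPn => _; first by rewrite mul1e ger0_norm.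
  by rewrite mul0e.
have := ge0_integral_scaled_law mV mU U0
  (Rintegral_ge0 P (fun x _ => U0 x)) UVA mn (fun=> normr_ge0 _).
under [X in _ = _ * X -> _]eq_integral do rewrite ger0_norm//.
by move=> <- //; apply: eq_integral => x _; rewrite ger0_norm// EFinM.
Qed.

Lemma integrable_indepM (U V : T -> R) :
  P.-integrable setT (EFin \o U) -> P.-integrable setT (EFin \o V) ->
  independent P U V -> P.-integrable setT (EFin \o (U \* V)%R).
Proof.
move=> iU iV UV.
have mU : measurable_fun setT U by apply/measurable_EFinP; exact: measurable_int iU.
have mV : measurable_fun setT V by apply/measurable_EFinP; exact: measurable_int iV.
apply/integrableP; split; first by apply/measurable_EFinP; exact: measurable_funM.
have := @ge0_integral_indepM (fun x => `|U x|%R) (fun x => `|V x|%R).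
rewrite (_ : \int[P]_x `|_| = \int[P]_x (`|U x|%R * `|V x|%R)%:E); last first.
  by apply: eq_integral => x _; rewrite /= normrM.
move=> ->//; try exact: measurableT_comp.
- rewrite lte_mul_pinfty//; first by rewrite lee_fin Rintegral_ge0.
  by have /integrableP[_] := iV.
- exact: integrable_norm.
- by apply: (independent_comp (f := fun y : R => `|y|%R) (g := fun y : R => `|y|%R)) => //; exact: normr_measurable.
Qed.

Lemma Rintegral_indepM (U V : T -> R) :
  P.-integrable setT (EFin \o U) -> P.-integrable setT (EFin \o V) ->
  independent P U V ->
  (\int[P]_x (U x * V x) = \int[P]_x U x * \int[P]_x V x)%R.
Proof.
move=> iU iV UV.
pose p (y : R) : R := Num.max y 0%R.
pose q (y : R) : R := Num.max (- y)%R 0%R.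
have mp : measurable_fun setT p by apply: measurable_maxr.
have mq : measurable_fun setT q by apply: measurable_maxr.
have pq y : (y = p y - q y)%R.
  by rewrite /p /q; case: (lerP y 0) => y0; case: (lerP (-y) 0); lra.
have ige (h : R -> R) (W : T -> R) : (forall y, (0 <= h y)%R) -> (forall y, (h y <= `|y|)%R) ->
    measurable_fun setT h ->
    P.-integrable setT (EFin \o W) -> P.-integrable setT (EFin \o (h \o W)).
  move=> h0 hle mh iW; have mW : measurable_fun setT W.
    by apply/measurable_EFinP; exact: measurable_int iW.
  apply: le_integrable iW => //.
    by apply/measurable_EFinP; exact: measurableT_comp.
  by move=> x _ /=; rewrite lee_fin ger0_norm.
have p0 y : (0 <= p y)%R by rewrite le_max lexx orbT.
have q0 y : (0 <= q y)%R by rewrite le_max lexx orbT.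
have pn y : (p y <= `|y|)%R by rewrite ge_max ler_norm normr_ge0.
have qn y : (q y <= `|y|)%R by rewrite ge_max -normrN ler_norm normr_ge0.
have ipU := ige _ _ p0 pn mp iU; have iqU := ige _ _ q0 qn mq iU.
have ipV := ige _ _ p0 pn mp iV; have iqV := ige _ _ q0 qn mq iV.
have prod (f g : R -> R) : measurable_fun setT f -> measurable_fun setT g ->
   (forall y, (0 <= f y)%R) -> (forall y, (0 <= g y)%R) ->
   P.-integrable setT (EFin \o (f \o U)) -> P.-integrable setT (EFin \o (g \o V)) ->
   (\int[P]_x (f (U x) * g (V x)) = \int[P]_x f (U x) * \int[P]_x g (V x))%R
   /\ P.-integrable setT (EFin \o ((f \o U) \* (g \o V))%R).
  move=> mf mg f0 g0 ifU igV; split.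
    rewrite {1}/Rintegral (@ge0_integral_indepM (f \o U) (g \o V))//=.
    + by rewrite fineM// integrable_fin_num.
    + by apply/measurable_EFinP; exact: measurable_int ifU.
    + by apply/measurable_EFinP; exact: measurable_int igV.
    + exact: independent_comp.
  by apply: integrable_indepM => //; exact: independent_comp.
(* The four products of a positive or negative part of [U] with one of [V]. *)
have [e1 i1] := prod _ _ mp mp p0 p0 ipU ipV.
have [e2 i2] := prod _ _ mp mq p0 q0 ipU iqV.
have [e3 i3] := prod _ _ mq mp q0 p0 iqU ipV.
have [e4 i4] := prod _ _ mq mq q0 q0 iqU iqV.
have -> : (\int[P]_x U x = \int[P]_x p (U x) - \int[P]_x q (U x))%R.
  by rewrite -RintegralB//; apply: eq_Rintegral => x _; exact: pq.
have -> : (\int[P]_x V x = \int[P]_x p (V x) - \int[P]_x q (V x))%R.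
  by rewrite -RintegralB//; apply: eq_Rintegral => x _; exact: pq.
have -> : (\int[P]_x (U x * V x) = \int[P]_x
   ((p (U x) * p (V x) - p (U x) * q (V x)) - (q (U x) * p (V x) - q (U x) * q (V x))))%R.
  by apply: eq_Rintegral => x _; rewrite {1}(pq (U x)) {1}(pq (V x)); ring.
rewrite RintegralB//; last 2 first.
  exact: (integrableB measurableT i1 i2).
  exact: (integrableB measurableT i3 i4).
by rewrite !RintegralB// e1 e2 e3 e4; ring.
Qed.

End products.

(** * Moments *)

Section moments.
Context d (T : measurableType d) (R : realType) (P : probability T R).
Implicit Types U V : T -> R.

Notation integrable U := (P.-integrable setT (EFin \o U)).

Lemma integrable_measurable U : integrable U -> measurable_fun setT U.
Proof. by move=> iU; apply/measurable_EFinP; exact: measurable_int iU. Qed.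

Lemma integral_EFin U : integrable U ->
  (\int[P]_x (U x)%:E = (\int[P]_x U x)%:E)%E.
Proof. by move=> iU; rewrite fineK// integrable_fin_num. Qed.

Lemma integrable_cst (c : R) : integrable (fun=> c).
Proof. exact: finite_measure_integrable_cst. Qed.

Lemma Rintegral_cst1 (c : R) : \int[P]_x c = c.
Proof.
rewrite Rintegral_cst// (_ : fine _ = 1) ?mulr1//.
exact: (congr1 fine (probability_setT P)).
Qed.

Lemma integrable_le U V : measurable_fun setT U -> (forall x, `|U x| <= `|V x|) ->
  integrable V -> integrable U.
Proof.
move=> mU UV iV; apply: le_integrable iV => //; first exact/measurable_EFinP.
by move=> x _ /=; rewrite lee_fin.
Qed.

Lemma integrable_addr U V : integrable U -> integrable V -> integrable (U \+ V).
Proof. by move=> iU iV; exact: (integrableD measurableT iU iV). Qed.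

Lemma integrable_subr U V : integrable U -> integrable V -> integrable (U \- V).
Proof. by move=> iU iV; exact: (integrableB measurableT iU iV). Qed.

Lemma integrable_mulr c U : integrable U -> integrable (fun x => c * U x).
Proof. by move=> iU; exact: (integrableZl measurableT c iU). Qed.

Lemma integrable_sumr (I : Type) (s : seq I) (p : pred I) (U : I -> T -> R) :
  (forall i, integrable (U i)) -> integrable (fun x => \sum_(i <- s | p i) U i x).
Proof.
move=> iU; rewrite (_ : EFin \o _ = (fun x => \sum_(i <- s | p i) (U i x)%:E)%E).
  by apply: integrable_sum => // i _; exact: iU.
by apply/funext => x /=; rewrite sumEFin.
Qed.

Lemma Rintegral_sum (I : Type) (s : seq I) (p : pred I) (U : I -> T -> R) :
  (forall i, integrable (U i)) ->
  \int[P]_x (\sum_(i <- s | p i) U i x) = \sum_(i <- s | p i) \int[P]_x U i x.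
Proof.
move=> iU; apply: EFin_inj; rewrite -integral_EFin; last exact: integrable_sumr.
under eq_integral do rewrite -sumEFin.
rewrite integral_sum// -sumEFin; apply: eq_bigr => i _; exact: integral_EFin.
Qed.

Lemma Rintegral_le_cst U c : integrable U -> (forall x, U x <= c) ->
  \int[P]_x U x <= c.
Proof.
move=> iU Uc; rewrite -[leRHS]Rintegral_cst1; apply: le_Rintegral => //.
exact: integrable_cst.
Qed.

Lemma square_integrableM U V : measurable_fun setT U -> measurable_fun setT V ->
  integrable (fun x => U x ^+ 2) -> integrable (fun x => V x ^+ 2) ->
  integrable (fun x => U x * V x).
Proof.
move=> mU mV iU iV; apply: (integrable_le _ _ (integrable_addr iU iV)).
  exact: measurable_funM.
move=> x /=; rewrite [leRHS]ger0_norm ?addr_ge0 ?sqr_ge0// ler_norml.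
by apply/andP; split; have := sqr_ge0 (U x + V x); have := sqr_ge0 (U x - V x); nra.
Qed.

Lemma square_integrable U : measurable_fun setT U ->
  integrable (fun x => U x ^+ 2) -> integrable U.
Proof.
move=> mU iU; have := @square_integrableM U (fun=> 1) mU (measurable_cst _) iU.
by under [fun x => U x * 1]eq_fun do rewrite mulr1; apply; exact: integrable_cst.
Qed.

(** Orthogonality makes the cross terms of the square vanish. *)
Lemma second_moment_sum (n : nat) (U : 'I_n -> T -> R) (c : 'I_n -> R) (s : R) :
  (forall k, measurable_fun setT (U k)) ->
  (forall k, integrable (fun x => U k x ^+ 2)) ->
  (forall j k, j != k -> \int[P]_x (U j x * U k x) = 0) ->
  (forall k, \int[P]_x (U k x ^+ 2) <= s) ->
  integrable (fun x => (\sum_(k < n) c k * U k x) ^+ 2) /\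
  \int[P]_x ((\sum_(k < n) c k * U k x) ^+ 2) <= s * \sum_(k < n) c k ^+ 2.
Proof.
move=> mU iU U0 Us.
have E x : (\sum_(k < n) c k * U k x) ^+ 2 =
    \sum_(j < n) \sum_(k < n) (c j * c k) * (U j x * U k x).
  rewrite expr2 big_distrl/=; apply: eq_bigr => j _.
  by rewrite big_distrr/=; apply: eq_bigr => k _; ring.
have ijk j k : integrable (fun x => (c j * c k) * (U j x * U k x)).
  by apply: integrable_mulr; exact: square_integrableM.
have -> : (fun x => (\sum_(k < n) c k * U k x) ^+ 2) =
   (fun x => \sum_(j < n) \sum_(k < n) (c j * c k) * (U j x * U k x)).
  exact/funext.
split; first by do 2 (apply: integrable_sumr => ?).
rewrite Rintegral_sum => [|j]; last exact: integrable_sumr.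
rewrite mulr_sumr; apply: ler_sum => j _.
rewrite Rintegral_sum// (bigD1 j)//= big1 => [|k kj].
  rewrite addr0 RintegralZl//; last exact: square_integrableM.
  under eq_Rintegral do rewrite -expr2.
  by rewrite -expr2 mulrC ler_wpM2r// sqr_ge0.
rewrite RintegralZl//; last exact: square_integrableM.
by rewrite U0 ?mulr0// eq_sym.
Qed.

(** Dominated convergence, as the tails of [U] vanish pointwise. *)
Lemma truncation U : integrable U -> forall e : R, 0 < e -> exists2 M : R, 0 < M &
  (\int[P]_x (`|U x| * (M < `|U x|)%R%:R)%:E <= e%:E)%E.
Proof.
move=> iU e e0; have mU := integrable_measurable iU.
pose f n x : \bar R := (`|U x| * (n.+1%:R < `|U x|)%R%:R)%:E.
have mf n : measurable_fun setT (f n).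
  apply/measurable_EFinP; apply: measurable_funM; first exact: measurableT_comp.
  by apply: measurable_exceedance; exact: measurableT_comp.
have f0 x : f ^~ x @ \oo --> 0%E.
  apply: cvg_near_cst; near=> n; rewrite /f.
  rewrite ltNge (_ : `|U x| <= n.+1%:R) ?mulr0//.
  rewrite (le_trans (ltW (truncnS_gt _)))// ler_nat ltnS.
  by near: n; exact: nbhs_infty_ge.
have fU x n : (`|f n x| <= `|U x|%:E)%E.
  by rewrite /f lee_fin normrM normr_id normr_nat ler_piMr// lern1 leq_b1.
have [_ _ ] := @dominated_convergence _ _ _ P setT measurableT f (cst 0%E)
  (fun x => `|U x|%:E) mf (measurable_cst _) (aeW _ (fun x _ => f0 x))
  (integrable_norm iU) (aeW _ (fun x n _ => fU x n)).
rewrite /= integral0 => f0'.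
have [n _ /(_ n (leqnn n)) fn] := cvge0_near_lt f0' e0.
by exists n.+1%:R => //; exact: ltW.
Unshelve. all: by end_near. Qed.

End moments.

(** * The weak law of large numbers *)

Section weak_law.
Context d0 (T0 : measurableType d0) (R : realType) (P : probability T0 R).
Variable W0 : T0 -> R.
Hypothesis iW0 : P.-integrable setT (EFin \o W0).

(** Every variable is split at the level [M] into a bounded part [tr] and a tail
    [tl]. The average [A] of the centered bounded parts satisfies
    [`|A| <= e + A ^ 2 / e], and by pairwise independence its second moment is
    at most [4 M ^ 2 / n]. The tails cost [e] twice, in the average and in the
    mean. In this form the bound separates the choice of [M] from that of
    [n]. *)
Lemma mean_L1_bound d (T : measurableType d) (Q : probability T R) (n : nat)
    (W : 'I_n -> T -> R) (M e : R) :
  (0 < n)%N -> 0 < M -> 0 < e ->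
  (\int[P]_x (`|W0 x| * (M < `|W0 x|)%R%:R)%:E <= e%:E)%E ->
  (forall k, measurable_fun setT (W k)) ->
  (forall k, same_law Q (W k) P W0) ->
  (forall j k, j != k -> independent Q (W j) (W k)) ->
  (\int[Q]_x `|n%:R^-1 * (\sum_(k < n) W k x)%R - \int[P]_y W0 y|%:E <=
     (3 * e + 4 * M ^+ 2 / (n%:R * e))%:E)%E.
Proof.
move=> n0 M0 e0 We mW WW0 Wi.
have n0' : n%:R != 0 :> R by rewrite pnatr_eq0 -lt0n.
have mW0 := integrable_measurable iW0.
pose b (y : R) : R := (M < `|y|)%R%:R.
have mb : measurable_fun setT b.
  by apply: measurable_exceedance; exact: normr_measurable.
pose tl (y : R) : R := y * b y.
pose tr (y : R) : R := y * (1 - b y).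
have mtl : measurable_fun setT tl by exact: measurable_funM.
have mtr : measurable_fun setT tr.
  by apply: measurable_funM => //; apply: measurable_funB.
have trM y : `|tr y| <= M.
  rewrite /tr /b; case: ltP => h; first by rewrite subrr mulr0 normr0 ltW.
  by rewrite subr0 mulr1.
have tltr y : y = tr y + tl y by rewrite /tr /tl; ring.
have itl : P.-integrable setT (EFin \o (tl \o W0)).
  apply: integrable_le iW0; first exact: measurableT_comp.
  move=> x /=; rewrite /tl /b normrM normr_nat ler_piMr// lern1 leq_b1 //.
have itr : P.-integrable setT (EFin \o (tr \o W0)).
  apply: integrable_le (integrable_cst P M); first exact: measurableT_comp.
  by move=> x; rewrite (le_trans (trM _)) ?ler_norm.
set m := \int[P]_x tr (W0 x).
have eW0 : \int[P]_y W0 y = m + \int[P]_y tl (W0 y).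
  by rewrite -RintegralD//; apply: eq_Rintegral => x _; exact: tltr.
have abstl : \int[P]_y `|tl (W0 y)| <= e.
  rewrite -lee_fin -integral_EFin; last exact: integrable_norm.
  apply: le_trans We; rewrite le_eqVlt; apply/orP; left; apply/eqP.
  by apply: eq_integral => x _; rewrite /tl /b normrM normr_nat.
have mM : `|m| <= M.
  apply: (le_trans (le_normr_Rintegral measurableT itr)).
  exact: (Rintegral_le_cst (integrable_norm itr) (fun x => trM (W0 x))).
pose A x := \sum_(k < n) n%:R^-1 * (tr (W k x) - m).
have mtW k : measurable_fun setT (fun x => tr (W k x) - m).
  by apply: measurable_funB => //; exact: measurableT_comp.
have bnd k x : `|tr (W k x) - m| <= 2 * M.
  by rewrite (le_trans (ler_normB _ _))// mulrDl mul1r lerD.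
have iC k : Q.-integrable setT (EFin \o (fun x => tr (W k x) - m)).
  apply: integrable_le (integrable_cst Q (2 * M)) => // x.
  by rewrite (le_trans (bnd _ _))// ler_norm.
have bnd2 k x : `|(tr (W k x) - m) ^+ 2| <= 4 * M ^+ 2.
  rewrite normrX (_ : 4 * M ^+ 2 = (2 * M) ^+ 2); last by ring.
  by rewrite lerXn2r// nnegrE// ltW// mulr_gt0.
have iC2 k : Q.-integrable setT (EFin \o (fun x => (tr (W k x) - m) ^+ 2)).
  apply: integrable_le (integrable_cst Q (4 * M ^+ 2)).
    exact: measurable_funX.
  by move=> x; rewrite (le_trans (bnd2 _ _))// ler_norm.
have C0 k : \int[Q]_x (tr (W k x) - m) = 0.
  have itrk : Q.-integrable setT (EFin \o (tr \o W k)).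
    apply: (same_law_integrable _ _ (same_law_comp mtr (WW0 k)) itr).
      exact: measurableT_comp.
    exact: measurableT_comp.
  rewrite RintegralB//; last exact: integrable_cst.
  rewrite Rintegral_cst1 (same_law_Rintegral (U := tr \o W k) (U0 := tr \o W0) (P := P)).
  - exact: subrr.
  - exact: measurableT_comp.
  - exact: measurableT_comp.
  - exact: same_law_comp.
have CC j k : j != k -> \int[Q]_x ((tr (W j x) - m) * (tr (W k x) - m)) = 0.
  move=> jk; rewrite Rintegral_indepM ?C0 ?mul0r//.
  apply: (independent_comp (f := fun y => tr y - m) (g := fun y => tr y - m)
    _ _ (Wi _ _ jk)); exact: measurable_funB.
have C2 k : \int[Q]_x ((tr (W k x) - m) ^+ 2) <= 4 * M ^+ 2.
  by apply: Rintegral_le_cst => // x; rewrite (le_trans (ler_norm _)).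
have [iA A2] := second_moment_sum (fun=> n%:R^-1) mtW iC2 CC C2.
have mA : measurable_fun setT A.
  by apply: measurable_sum => k; apply: measurable_funM.
pose B x := e + A x ^+ 2 / e + \sum_(k < n) n%:R^-1 * `|tl (W k x)| + e.
have mtlk k : measurable_fun setT (fun x => `|tl (W k x)|).
  by apply: measurableT_comp => //; exact: measurableT_comp.
pose ntl (y : R) : R := `|tl y|.
have mntl : measurable_fun setT ntl by exact: measurableT_comp.
have tlk k : same_law Q (ntl \o W k) P (ntl \o W0) by exact: same_law_comp.
have itlk k : Q.-integrable setT (EFin \o (fun x => `|tl (W k x)|)).
  apply: (same_law_integrable _ _ (tlk k) (integrable_norm itl)) => //;
    exact: measurableT_comp.
have {}iA : Q.-integrable setT (EFin \o (fun x => A x ^+ 2)) := iA.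
have iA' : Q.-integrable setT (EFin \o (fun x => A x ^+ 2 / e)).
  under [fun x => _ / e]eq_fun do rewrite mulrC.
  by apply: integrable_mulr.
have iB1 : Q.-integrable setT (EFin \o (fun x => e + A x ^+ 2 / e)).
  by apply: integrable_addr => //; exact: integrable_cst.
have iB2 : Q.-integrable setT (EFin \o (fun x => \sum_(k < n) n%:R^-1 * `|tl (W k x)|)).
  by apply: integrable_sumr => k; exact: integrable_mulr.
have iB : Q.-integrable setT (EFin \o B).
  apply: integrable_addr; last exact: integrable_cst.
  exact: integrable_addr.
have VB x : `|n%:R^-1 * (\sum_(k < n) W k x) - \int[P]_y W0 y| <= B x.
  have -> : n%:R^-1 * (\sum_(k < n) W k x) - \int[P]_y W0 y =
     A x + n%:R^-1 * (\sum_(k < n) tl (W k x)) - \int[P]_y tl (W0 y).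
    rewrite /A -mulr_sumr sumrB sumr_const card_ord eW0.
    under eq_bigr do rewrite (tltr (W _ _)).
    by rewrite big_split/= mulrDr mulrBr -[m *+ n]mulr_natl mulKf//; ring.
  rewrite (le_trans (ler_normB _ _))// /B lerD//.
    rewrite (le_trans (ler_normD _ _))// lerD//; last first.
      rewrite mulr_sumr (le_trans (ler_norm_sum _ _ _))// ler_sum// => k _.
      by rewrite normrM ger0_norm// invr_ge0.
    have [h|h] := leP `|A x| e.
      by rewrite (le_trans h)// lerDl divr_ge0 ?sqr_ge0// ltW.
    rewrite -[leLHS]add0r lerD// ?(ltW e0)// ler_pdivlMr// -real_normK ?num_real//.
    by rewrite expr2 ler_wpM2l// ltW.
  by rewrite (le_trans (le_normr_Rintegral measurableT itl)).
apply: (@le_trans _ _ (\int[Q]_x (B x)%:E)%E).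
  apply: ge0_le_integral => //.
  - apply/measurable_EFinP; apply: measurableT_comp => //.
    apply: measurable_funB => //; apply: measurable_funM => //.
    by apply: measurable_sum => k.
  - by apply/measurable_EFinP; exact: integrable_measurable iB.
  - by move=> x _; rewrite lee_fin.
rewrite integral_EFin// lee_fin /B.
rewrite RintegralD//; last 2 first.
  exact: integrable_addr.
  exact: integrable_cst.
rewrite RintegralD// RintegralD//; last exact: integrable_cst.
rewrite !Rintegral_cst1 RintegralZr// Rintegral_sum; last first.
  by move=> k; exact: integrable_mulr.
have tlI k : \int[Q]_x `|tl (W k x)| = \int[P]_x `|tl (W0 x)|.
  by apply: (same_law_Rintegral _ _ (tlk k)); exact: measurableT_comp.
have -> : \sum_(k < n) \int[Q]_x (n%:R^-1 * `|tl (W k x)|) = \int[P]_x `|tl (W0 x)|.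
  under eq_bigr => k _ do rewrite RintegralZl// tlI.
  by rewrite sumr_const card_ord -mulrnAl -mulr_natr mulVf// mul1r.
have -> : 3 * e + 4 * M ^+ 2 / (n%:R * e) = e + (4 * M ^+ 2 / n%:R) / e + e + e.
  by rewrite invfM; ring.
rewrite lerD// lerD// lerD// ler_pM2r ?invr_gt0//.
rewrite (le_trans A2)// sumr_const card_ord -[_ *+ n]mulr_natr.
by rewrite (_ : n%:R^-1 ^+ 2 * n%:R = n%:R^-1)//; field.
Qed.

End weak_law.

(** The rows of the array live on different spaces and only a first moment is
    available, as for the product of two square integrable variables; hence
    the truncation. *)
Lemma weak_law_of_large_numbers d0 (T0 : measurableType d0) (R : realType)
    (P : probability T0 R) (W0 : T0 -> R)
    (d : nat -> measure_display) (Om : forall r, measurableType (d r))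
    (Q : forall r, probability (Om r) R) (n : nat -> nat)
    (W : forall r, 'I_(n r) -> Om r -> R) :
  P.-integrable setT (EFin \o W0) -> n r @[r --> \oo] --> \oo ->
  (forall r k, measurable_fun setT (W r k)) ->
  (forall r k, same_law (Q r) (W r k) P W0) ->
  (forall r j k, j != k -> independent (Q r) (W r j) (W r k)) ->
  onS (fun r w => (n r)%:R^-1 * \sum_(k < n r) W r k w) @ whp Q -->
    \int[P]_x W0 x.
Proof.
move=> iW0 noo mW WW0 Wi; apply/subr_cvg0.
have := @cvg_L1_whp R d Om Q
  (fun r w => (n r)%:R^-1 * (\sum_(k < n r) W r k w) - \int[P]_x W0 x).
apply.
  move=> r; apply: measurable_funB => //; apply: measurable_funM => //.
  by apply: measurable_sum.
apply: cvge0P => [r|e e0]; first by apply: integral_ge0 => x _; rewrite lee_fin.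
have e4 : 0 < e / 4 by rewrite divr_gt0.
have [M M0 We] := truncation iW0 e4.
have : \forall r \near \oo, (Num.truncn (4 * M ^+ 2 / (e / 4) ^+ 2) < n r)%N.
  exact: (noo _ (nbhs_infty_gt _)).
apply: filterS => r nr.
have n0 : (0 < n r)%N by apply: leq_ltn_trans nr.
apply: (le_trans (mean_L1_bound iW0 n0 M0 e4 We (mW r) (WW0 r) (Wi r))).
rewrite lee_fin -lerBrDl (_ : e - 3 * (e / 4) = e / 4); last by field.
rewrite ler_pdivrMr ?mulr_gt0 ?ltr0n//.
rewrite (_ : e / 4 * ((n r)%:R * (e / 4)) = (n r)%:R * (e / 4) ^+ 2); last by ring.
rewrite -ler_pdivrMr ?exprn_gt0//.
by rewrite (le_trans (ltW (truncnS_gt _)))// ler_nat.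
Qed.

(** * Tails of linear combinations of independent variables *)

Section mutual_independence.
Context d d' (T : measurableType d) (T' : measurableType d') (R : realType)
  (P : probability T R).

Lemma mutually_independent_pair (I : choiceType) (U : I -> T -> T') (i j : I) :
  mutually_independent P U -> i != j -> independent P (U i) (U j).
Proof.
move=> iU ij A B mA mB.
pose C l := if l == i then A else B.
have jNi : (j == i) = false by rewrite eq_sym; exact/negbTE.
have := iU [fset i; j]%fset C.
rewrite big_fsetU1 ?inE//= big_seq_fset1 /C eqxx jNi => <-.
  congr (P _); apply/seteqP; split=> w /=.
    by move=> [Ai Bj] l /=; rewrite !inE => /orP[]/eqP ->; rewrite ?eqxx// jNi.
  move=> Cw; split.
    by have := Cw i; rewrite /= !inE eqxx/=; apply.
  by have := Cw j; rewrite /= !inE eqxx orbT jNi/=; apply.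
by move=> l _; case: ifPn.
Qed.

Variables (X : nat -> T -> T') (f : nat -> T' -> R).
Hypotheses (mX : forall j, measurable_fun setT (X j))
  (iX : mutually_independent P X)
  (mf : forall j, measurable_fun setT (f j)) (f0 : forall j y, 0 <= f j y)
  (fX : forall j, P.-integrable setT (EFin \o (f j \o X j))).

Let mpre j A : measurable A -> measurable (X j @^-1` A).
Proof. by move=> mA; rewrite -[X in measurable X]setTI; exact: mX. Qed.

Let mcap (J : {fset nat}) (A : nat -> set T') :
  (forall j, j \in J -> measurable (A j)) ->
  measurable (\bigcap_(j in [set` J]) (X j @^-1` A j)).
Proof.
move=> mA; apply: fin_bigcap_measurable; first exact: finite_fset.
by move=> j jJ; apply/mpre/mA.
Qed.

Let prod_ge0 k x : 0 <= \prod_(j < k) f j (X j x).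
Proof. by apply: prodr_ge0 => j _; exact: f0. Qed.

Let mprod k : measurable_fun setT (fun x => \prod_(j < k) f j (X j x)).
Proof.
elim: k => [|k IH].
  by under eq_fun do rewrite big_ord0; exact: measurable_cst.
under eq_fun do rewrite big_ord_recr/=.
by apply: measurable_funM => //; exact: measurableT_comp.
Qed.

Let prod_cap k (J : {fset nat}) (A : nat -> set T') :
  (forall j, j \in J -> (k <= j)%N) ->
  (forall j, j \in J -> measurable (A j)) ->
  (\int[P]_(x in \bigcap_(j in [set` J]) (X j @^-1` A j))
    (\prod_(j < k) f j (X j x))%:E =
  (\prod_(j < k) \int[P]_x f j (X j x))%:E *
    P (\bigcap_(j in [set` J]) (X j @^-1` A j)))%E.
Proof.
elim: k J A => [|k IH] J A kJ mA.
  rewrite big_ord0 mul1e.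
  under eq_integral do rewrite big_ord0.
  by rewrite integral_cst ?mul1e//; exact: mcap.
set B := \bigcap_(j in _) _.
have mB : measurable B by exact: mcap.
pose F x := (\prod_(j < k) f j (X j x)) * \1_B x.
have m1 : measurable_fun setT (\1_B : T -> R) by exact: measurable_indic.
have mF : measurable_fun setT F by exact: measurable_funM.
have F0 x : 0 <= F x by rewrite mulr_ge0// indicE ler0n.
have kNJ : k \notin J by apply/negP => /kJ; rewrite ltnn.
pose c := (\prod_(j < k) \int[P]_x f j (X j x)) * fine (P B).
have c0 : 0 <= c.
  rewrite mulr_ge0// ?fine_ge0//; apply: prodr_ge0 => j _.
  by apply: Rintegral_ge0 => x _; exact: f0.
have FV C : measurable C ->
    (\int[P]_(x in X k @^-1` C) (F x)%:E = c%:E * P (X k @^-1` C))%E.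
  move=> mC; pose A' j := if j == k then C else A j.
  have A'J j : j \in J -> A' j = A j.
    by move=> jJ; rewrite /A'; case: eqP => // jk; rewrite -jk jJ in kNJ.
  have mA' j : j \in (k |` J)%fset -> measurable (A' j).
    rewrite !inE => /orP[/eqP->|jJ]; first by rewrite /A' eqxx.
    by rewrite A'J//; exact: mA.
  have capE : \bigcap_(j in [set` (k |` J)%fset]) (X j @^-1` A' j) =
      X k @^-1` C `&` B.
    apply/seteqP; split=> x /=.
      move=> Ax; split.
        by have := Ax k; rewrite /= !inE eqxx /A' eqxx; apply.
      move=> j /= jJ; have := Ax j; rewrite /= !inE jJ orbT A'J//; exact.
    move=> [Cx Bx] j /=; rewrite !inE => /orP[/eqP->|jJ].
      by rewrite /A' eqxx.
    by rewrite A'J//; exact: Bx.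
  have := IH (k |` J)%fset A' _ mA'.
  rewrite capE integral_mkcondr => IH'.
  transitivity (\int[P]_(x in X k @^-1` C)
      ((fun x => (\prod_(j < k) f j (X j x))%:E) \_ B) x)%E.
    apply: eq_integral => x _; rewrite patchE /F indicE.
    by case: ifPn => _; rewrite ?mulr1 ?mulr0.
  rewrite IH' => [|j]; last first.
    by rewrite !inE => /orP[/eqP->//|/kJ]; exact: ltnW.
  rewrite -capE (iX mA') big_fsetU1//= {1}/A' eqxx /c EFinM fineK ?fin_num_measure//.
  rewrite -[RHS]muleA; congr (_ * _)%E.
  rewrite muleC; congr (_ * _)%E.
  rewrite /B (iX mA); apply: eq_big_seq => j jJ; by rewrite A'J.
have := ge0_integral_scaled_law (mX k) mF F0 c0 FV
  (f := EFin \o f k) ((measurable_EFinP _ _).2 (mf k)) (fun y => f0 k y).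
move=> H; rewrite integral_mkcond big_ord_recr/=.
transitivity (\int[P]_x ((F x)%:E * (f k (X k x))%:E))%E.
  apply: eq_integral => x _; rewrite patchE /F indicE big_ord_recr/=.
  by case: ifPn => _; rewrite ?mulr1 ?mulr0 ?mul0e// EFinM.
have fPB : P B \is a fin_num by rewrite fin_num_measure.
apply: (etrans H); rewrite (integral_EFin (fX k)) /c -[in RHS](fineK fPB).
by rewrite -!EFinM mulrAC.
Qed.

(** By induction on the number of factors. The variables not yet integrated
    enter through an event, because independence speaks of events only. *)
Lemma ge0_integral_prod k :
  (\int[P]_x (\prod_(j < k) f j (X j x))%:E =
   (\prod_(j < k) \int[P]_x f j (X j x))%:E)%E.
Proof.
have := @prod_cap k fset0 (fun=> setT) (fun j => ltac:(by rewrite inE))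
  (fun j => ltac:(by rewrite inE)).
rewrite (_ : \bigcap_(j in _) _ = setT); last first.
  by rewrite -subTset => x _ j /=; rewrite inE.
by rewrite probability_setT mule1.
Qed.

End mutual_independence.

Section tails.
Context d (T : measurableType d) (R : realType) (P : probability T R).
Variables (U : nat -> T -> R) (p : nat) (c : nat -> R) (t s : R).
Hypotheses (mU : forall j, measurable_fun setT (U j))
  (iU : mutually_independent P U).
Let m j := \int[P]_x U j x.
Hypotheses (t0 : 0 < t) (s0 : 0 < s)
  (cs : \sum_(j < p) c j ^+ 2 <= s * t ^+ 2).

(** The variance of the linear combination is at most [v s t ^ 2]. *)
Lemma chebyshev_tail (v : R) : 0 <= v ->
  (forall j, P.-integrable setT (EFin \o (fun x => U j x ^+ 2))) ->
  (forall j, \int[P]_x ((U j x - m j) ^+ 2) <= v) ->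
  (P [set x | (\sum_(j < p) c j * (U j x - m j) <= - t)%R] <= (v * s)%:E)%E.
Proof.
move=> v0 iU2 Uv.
have iU1 j : P.-integrable setT (EFin \o U j) by exact: square_integrable.
have mUm j : measurable_fun setT (fun x => U j x - m j) by exact: measurable_funB.
have iUm j : P.-integrable setT (EFin \o (fun x => U j x - m j)).
  by apply: integrable_subr => //; exact: integrable_cst.
have iUm2 j : P.-integrable setT (EFin \o (fun x => (U j x - m j) ^+ 2)).
  have -> : (fun x => (U j x - m j) ^+ 2) =
      (fun x => U j x ^+ 2 + (m j ^+ 2 - (2 * m j) * U j x)).
    by apply/funext => x; ring.
  apply: integrable_addr => //; apply: integrable_subr; first exact: integrable_cst.
  exact: integrable_mulr.
have Um0 j : \int[P]_x (U j x - m j) = 0.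
  by rewrite RintegralB//= ?Rintegral_cst1 ?subrr//; exact: integrable_cst.
have Umm (j k : 'I_p) : j != k -> \int[P]_x ((U j x - m j) * (U k x - m k)) = 0.
  move=> jk; rewrite Rintegral_indepM ?Um0 ?mul0r//.
  have mg l : measurable_fun setT (fun y : R => y - m l) by exact: measurable_funB.
  exact: (independent_comp (mg j) (mg k) (mutually_independent_pair iU jk)).
have [iA A2] := second_moment_sum (fun k : 'I_p => c k) (fun k : 'I_p => mUm k)
  (fun k : 'I_p => iUm2 k) Umm (fun k : 'I_p => Uv k).
pose A x := (\sum_(j < p) c j * (U j x - m j)) ^+ 2.
have mA : measurable_fun setT A by exact: integrable_measurable iA.
apply: (@le_trans _ _ (P [set x | (t ^+ 2 <= A x)%R])).
  apply: le_measure; rewrite ?inE.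
  - apply: measurable_set_ler => //; apply: measurable_sum => j.
    exact: measurable_funM.
  - exact: measurable_set_ler.
  - move=> x /=; rewrite /A; set a := \sum_(j < p) _ => h.
    have tna : t <= - a by rewrite lerNr.
    have na0 : 0 <= - a by exact: le_trans (ltW t0) tna.
    by rewrite -(sqrrN a) lerXn2r// nnegrE ltW.
apply: (le_trans (markov_ge0 P mA _ _)).
- by move=> x; exact: sqr_ge0.
- by rewrite exprn_gt0.
rewrite integral_EFin// -EFinM lee_fin mulrC ler_pdivrMr ?exprn_gt0//.
by rewrite (le_trans A2)// -mulrA ler_wpM2l.
Qed.

Lemma subgaussian_tail (v : R) : 0 < v ->
  (forall l j, P.-integrable setT (EFin \o (fun x => expR (l * (U j x - m j)))) /\
     \int[P]_x expR (l * (U j x - m j)) <= expR (2^-1 * l ^+ 2 * v)) ->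
  (P [set x | (\sum_(j < p) c j * (U j x - m j) <= - t)%R] <=
     (expR (- (2 * v * s)^-1))%:E)%E.
Proof.
move=> v0 sg.
(* The exponent that minimizes the Chernoff bound [- l t + l ^ 2 v s t ^ 2 / 2]. *)
pose l := (v * s * t)^-1.
have l0 : 0 < l by rewrite invr_gt0 !mulr_gt0.
pose f j y := expR ((- (l * c j)) * (y - m j)).
have mf j : measurable_fun setT (f j).
  apply: measurableT_comp => //; apply: measurable_funM => //.
  exact: measurable_funB.
have mP : measurable_fun setT (fun x => \prod_(j < p) f j (U j x)).
  by apply: measurable_prod => j _; exact: measurableT_comp.
have prodE x : \prod_(j < p) f j (U j x) =
    expR (- l * \sum_(j < p) c j * (U j x - m j)).
  rewrite mulr_sumr expR_sum; apply: eq_bigr => j _; rewrite /f.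
  by congr expR; ring.
apply: (@le_trans _ _ (P [set x | (expR (l * t) <= \prod_(j < p) f j (U j x))%R])).
  apply: le_measure; rewrite ?inE.
  - apply: measurable_set_ler => //; apply: measurable_sum => j.
    by apply: measurable_funM => //; exact: measurable_funB.
  - exact: measurable_set_ler.
  - by move=> x /= h; rewrite prodE ler_expR; nra.
apply: (le_trans (markov_ge0 P mP _ (expR_gt0 _))).
  by move=> x; apply: prodr_ge0 => j _; exact: expR_ge0.
rewrite ge0_integral_prod//; last 2 first.
- by move=> j y; exact: expR_ge0.
- by move=> j; have [] := sg (- (l * c j)) j.
rewrite -EFinM lee_fin.
have : \prod_(j < p) \int[P]_x f j (U j x) <=
   \prod_(j < p) expR (2^-1 * (- (l * c j)) ^+ 2 * v).
  apply: ler_prod => j _; apply/andP; split.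
    by apply: Rintegral_ge0 => x _; exact: expR_ge0.
  by have [] := sg (- (l * c j)) j.
move=> /(ler_wpM2l (ltW (expR_gt0 (- (l * t))))).
rewrite expRN => /le_trans; apply.
rewrite -expRN -expR_sum -expRD ler_expR.
have -> : \sum_(j < p) 2^-1 * (- (l * c j)) ^+ 2 * v =
   2^-1 * l ^+ 2 * v * \sum_(j < p) c j ^+ 2.
  by rewrite mulr_sumr; apply: eq_bigr => j _; ring.
have h : 0 <= 2^-1 * l ^+ 2 * v.
  by rewrite mulr_ge0 ?(ltW v0)// mulr_ge0 ?sqr_ge0// invr_ge0.
apply: (@le_trans _ _ (- (l * t) + 2^-1 * l ^+ 2 * v * (s * t ^+ 2))).
  by rewrite lerD2l ler_wpM2l.
rewrite /l le_eqVlt; apply/orP; left; apply/eqP; field.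
by rewrite !gt_eqF.
Qed.

End tails.

(** * Geometry of the nearest center *)

Section geometry.
Context (R : realType) (p : nat).
Implicit Types x a b : p.-tuple R.

Lemma l2dist_sqr x a : l2dist x a ^+ 2 = \sum_(j < p) (tnth x j - tnth a j) ^+ 2.
Proof. by rewrite sqr_sqrtr// sumr_ge0// => j _; exact: sqr_ge0. Qed.

(** Write [D] for the distance between the true centers [mz] and [mv]. Twice the
    inner product of [a - b] with [x - mz] is the difference of the squared
    distances of [x] to [b] and to [a], which is nonpositive, minus the same
    difference for [mz], which is at least [((9 / 10) ^ 2 - (1 / 10) ^ 2) D ^ 2];
    this gives [2 / 5]. The distance from [a] to [b] is at most
    [D + 2 D / 10], whose square gives [36 / 25]. *)
Lemma nearest_wrong_center x mz mv a b :
  l2dist x b <= l2dist x a ->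
  l2dist mz a <= l2dist mz mv / 10 -> l2dist mv b <= l2dist mz mv / 10 ->
  \sum_(j < p) (tnth a j - tnth b j) * (tnth x j - tnth mz j) <=
    - (2 / 5 * l2dist mz mv ^+ 2) /\
  \sum_(j < p) (tnth a j - tnth b j) ^+ 2 <= 36 / 25 * l2dist mz mv ^+ 2.
Proof.
have sqr_le (u v : R) : 0 <= u -> 0 <= v -> u <= v -> u ^+ 2 <= v ^+ 2.
  by move=> u0 v0 uv; rewrite lerXn2r// nnegrE.
have d0 u v : 0 <= l2dist (p := p) (R := R) u v by exact: sqrtr_ge0.
move=> /(sqr_le _ _ (d0 _ _) (d0 _ _)) xba.
have D0 : 0 <= l2dist mz mv / 10 by rewrite divr_ge0.
move=> /(sqr_le _ _ (d0 _ _) D0) mza /(sqr_le _ _ (d0 _ _) D0) mvb.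
rewrite expr_div_n in mza mvb; rewrite !l2dist_sqr in xba mza mvb *.
set D2 := \sum_(j < p) (tnth mz j - tnth mv j) ^+ 2 in mza mvb *.
split.
  (* Coordinatewise, [(u + v) ^ 2 >= (9 / 10) u ^ 2 - 9 v ^ 2] replaces the
     triangle inequality; the weights are those that are sharp when [`|v|] is a
     tenth of [`|u|]. *)
  have key : 2 * \sum_(j < p) (tnth a j - tnth b j) * (tnth x j - tnth mz j) <=
      \sum_(j < p) (tnth x j - tnth b j) ^+ 2 - \sum_(j < p) (tnth x j - tnth a j) ^+ 2
      - 9 / 10 * D2 + 9 * \sum_(j < p) (tnth mv j - tnth b j) ^+ 2
      + \sum_(j < p) (tnth mz j - tnth a j) ^+ 2.
    rewrite /D2 !mulr_sumr -!sumrN -!big_split/=; apply: ler_sum => j _.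
    have := sqr_ge0 (tnth mz j - tnth mv j + 10 * (tnth mv j - tnth b j)).
    nra.
  lra.
(* Cauchy-Schwarz with the weights [10, 1, 1], sharp for errors of [D / 10]. *)
have key : \sum_(j < p) (tnth a j - tnth b j) ^+ 2 <= 6 / 5 * D2 +
    12 * \sum_(j < p) (tnth mz j - tnth a j) ^+ 2 +
    12 * \sum_(j < p) (tnth mv j - tnth b j) ^+ 2.
  rewrite /D2 !mulr_sumr -!big_split/=; apply: ler_sum => j _.
  set d := tnth mz j - tnth mv j; set e := tnth mz j - tnth a j.
  set f := tnth mv j - tnth b j.
  have -> : tnth a j - tnth b j = d - e + f by rewrite /d /e /f; ring.
  have := sqr_ge0 (d + 10 * e); have := sqr_ge0 (d - 10 * f).
  have := sqr_ge0 (e + f); nra.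
lra.
Qed.

End geometry.

(** * Conditioning on the label *)

Section conditional.
Context d (Om : measurableType d) (R : realType) (P : probability Om R)
  (K : nat) (X : nat -> {RV P >-> R}) (Z : {RV P >-> 'I_K.+1}).
Hypothesis hZ : forall z, (0 < P (Z @^-1` [set z]))%E.

Definition label_prob z : R := fine (P (Z @^-1` [set z])).

Lemma label_probE z : (P (Z @^-1` [set z]) = (label_prob z)%:E)%E.
Proof. by rewrite fineK// fin_num_measure//; exact: measurable_label. Qed.

Lemma label_prob_gt0 z : 0 < label_prob z.
Proof. by rewrite -lte_fin -label_probE. Qed.

Lemma cond_probE z A :
  cond_prob Z z A = (P (A `&` Z @^-1` [set z]) * ((label_prob z)^-1)%:E)%E.
Proof.
rewrite /cond_prob/= /mnormalize/= /mrestr !setTI.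
by rewrite ifF// label_probE; apply/negbTE; rewrite negb_or eqe gt_eqF ?label_prob_gt0.
Qed.

Lemma cond_prob_ge z A : measurable A ->
  (P (A `&` Z @^-1` [set z]) <= cond_prob Z z A)%E.
Proof.
move=> mA; rewrite cond_probE lee_pemulr//.
by rewrite lee_fin invf_ge1 ?label_prob_gt0// -lee_fin -label_probE probability_le1//;
    exact: measurable_label.
Qed.

End conditional.

(** * The probability of misclassification *)

Lemma measurable_fiber d (T : measurableType d) K (f : T -> 'I_K.+1) z :
  measurable_fun setT f -> measurable [set w | f w = z].
Proof.
by move=> mf; rewrite -[X in measurable X]setTI; exact: (mf measurableT [set z]).
Qed.

(** Fubini: an independent variable may be frozen before bounding the
    probability of an event. *)
Lemma independent_section_bound d (T : measurableType d) d1 (T1 : measurableType d1)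
    d2 (T2 : measurableType d2) (R : realType) (Q : probability T R)
    (O : T -> T2) (M : T -> T1) (E : set (T1 * T2)) (c : \bar R) :
  measurable_fun setT O -> measurable_fun setT M -> independent Q O M ->
  measurable E -> (forall a, (Q [set w | E (a, O w)] <= c)%E) ->
  (Q [set w | E (M w, O w)] <= c)%E.
Proof.
move=> mO mM OM mE Ec.
have mMO : measurable_fun setT (fun w => (M w, O w)) by exact: measurable_fun_pair.
pose O' : {mfun T >-> T2} := HB.pack O (isMeasurableFun.Build _ _ _ _ O mO).
pose M' : {mfun T >-> T1} := HB.pack M (isMeasurableFun.Build _ _ _ _ M mM).
pose MO' : {mfun T >-> (T1 * T2)%type} :=
  HB.pack (fun w => (M w, O w)) (isMeasurableFun.Build _ _ _ _ _ mMO).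
have rect A B : measurable A -> measurable B ->
    distribution Q (MO' : {RV Q >-> _}) (A `*` B) =
    (distribution Q (M' : {RV Q >-> _}) A * distribution Q (O' : {RV Q >-> _}) B)%E.
  move=> mA mB; rewrite /distribution /pushforward/= muleC -(OM _ _ mB mA).
  by congr (Q _); apply/seteqP; split => w [].
have H := product_measure_unique rect mE.
rewrite (_ : Q _ = distribution Q (MO' : {RV Q >-> _}) E)// -H /product_measure1/=.
apply: (@le_trans _ _ (\int[distribution Q (M' : {RV Q >-> _})]_a cst c a)%E).
  apply: ge0_le_integral => //.
  - exact: measurable_fun_xsection.
  - move=> a _ /=; rewrite /distribution /pushforward/=.
    rewrite (_ : O @^-1` _ = [set w | E (a, O w)])//.
    by apply/seteqP; split=> w; rewrite /xsection/= inE.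
rewrite integral_cst// [X in (_ * X)%E](_ : _ = 1%E) ?mule1//.
exact: (probability_setT Q).
Qed.

Section misclassification.
Context d0 (Om0 : measurableType d0) (R : realType) (P : probability Om0 R)
  (K : nat) (X : nat -> {RV P >-> R}) (Y : {RV P >-> R}) (Z : {RV P >-> 'I_K.+1}).
Hypothesis hZ : forall z, (0 < P (Z @^-1` [set z]))%E.
Context d (Om : measurableType d) (Q : probability Om R) (n m p : nat)
  (S0 : {RV Q >-> m.-tuple (p.-tuple R)})
  (S : {RV Q >-> n.-tuple (observation R K p)}).
Hypothesis hdata : sampling X Y Z S0 S.
Context (mucheck : {mfun m.-tuple (p.-tuple R) >-> K.+1.-tuple (p.-tuple R)})
  (rule : {mfun (p.-tuple R * K.+1.-tuple (p.-tuple R))%type >-> 'I_K.+1})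
  (hrule : is_nearest_rule rule).

(** The common form of the Chebyshev and the Chernoff bound, so that
    misclassification is treated once. The parameter [s] is invariant under a
    joint scaling of the coefficients and of the threshold. *)
Definition tail_bound (tau : R -> R) := forall z (c : nat -> R) (t s : R),
  0 < t -> 0 < s -> \sum_(j < p) c j ^+ 2 <= s * t ^+ 2 ->
  (cond_prob Z z [set w | (\sum_(j < p) c j * (X j w - cmean X Z j z) <= - t)%R] <=
   (tau s)%:E)%E.

Lemma tail_bound_ge0 tau s : tail_bound tau -> 0 < s -> 0 <= tau s.
Proof.
move=> /(_ ord0 (fun=> 0) 1 s ltr01) H s0; rewrite -lee_fin.
apply: (le_trans _ (H s0 _)) => //.
by rewrite big1 ?mulr_ge0// ?(ltW s0)// => j _; rewrite expr0n.
Qed.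

Lemma measurable_obs k : measurable_fun setT (fun w => tnth (S w) k).
Proof.
exact: (measurableT_comp (measurable_tnth k) (measurable_funP S)).
Qed.

Lemma measurable_l2dist d1 (T : measurableType d1) (f g : T -> p.-tuple R) :
  measurable_fun setT f -> measurable_fun setT g ->
  measurable_fun setT (fun w => l2dist (f w) (g w)).
Proof.
move=> mf mg; apply: (@measurableT_comp _ _ _ _ _ _ (@Num.sqrt R)).
  by apply: continuous_measurable_fun; exact: sqrt_continuous.
apply: measurable_sum => j; apply: measurable_funX; apply: measurable_funB.
  exact: (measurableT_comp (measurable_tnth j) mf).
exact: (measurableT_comp (measurable_tnth j) mg).
Qed.

Lemma measurable_rel_error d1 (T : measurableType d1)
    (f : T -> K.+1.-tuple (p.-tuple R)) z v : measurable_fun setT f ->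
  measurable_fun setT (fun w => rel_error X Z (f w) z v).
Proof.
move=> mf; rewrite /rel_error; apply: measurable_funM => //.
apply: measurable_l2dist => //.
exact: (measurableT_comp (measurable_tnth z) mf).
Qed.

Lemma measurable_bad z v :
  measurable [set w | 10^-1 < rel_error X Z (mucheck (S0 w)) z v].
Proof.
apply: measurable_set_ltr => //; apply: measurable_rel_error.
exact: (measurableT_comp (measurable_funP mucheck) (measurable_funP S0)).
Qed.

Lemma measurable_obs_z k : measurable_fun setT (fun w => obs_z S w k).
Proof.
apply: (@measurableT_comp _ _ _ _ _ _ snd) => //.
apply: (@measurableT_comp _ _ _ _ _ _ fst) => //.
exact: measurable_obs.
Qed.

Lemma measurable_substitute k :
  measurable_fun setT (fun w => substitutes rule mucheck S0 S w k).
Proof.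
apply: (measurableT_comp (measurable_funP rule)); apply: measurable_fun_pair.
  apply: (@measurableT_comp _ _ _ _ _ _ fst) => //.
  apply: (@measurableT_comp _ _ _ _ _ _ fst) => //.
  exact: measurable_obs.
exact: (measurableT_comp (measurable_funP mucheck) (measurable_funP S0)).
Qed.

Lemma measurable_Xvec : measurable_fun setT (Xvec X p : Om0 -> p.-tuple R).
Proof.
apply/measurable_fun_tnthP => j.
rewrite (_ : _ \o _ = X j); first exact: measurable_funP.
by apply/funext => w; rewrite /= tnth_mktuple.
Qed.

Let D z v := l2dist (muvec X Z p z) (muvec X Z p v).

(** For centers that are not random: a wrong choice is a deviation as in
    [nearest_wrong_center], with threshold [t = 2 / 5 * D ^ 2], and
    [36 / 25 * D ^ 2] is [s * t ^ 2] for [s = 9 / D ^ 2]. *)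
Lemma fixed_centers_bound tau z v (mu : K.+1.-tuple (p.-tuple R)) :
  tail_bound tau -> 0 < D z v ->
  rel_error X Z mu z v <= 10^-1 -> rel_error X Z mu v z <= 10^-1 ->
  (P [set w | Z w = z /\ rule (Xvec X p w, mu) = v] <=
     (tau (9 / D z v ^+ 2))%:E)%E.
Proof.
move=> Htau Dzv; rewrite /rel_error.
have Dvz : l2dist (muvec X Z p v) (muvec X Z p z) = D z v.
  by rewrite /D /l2dist; congr Num.sqrt; apply: eq_bigr => j _; rewrite -sqrrN opprB.
rewrite Dvz -/(D z v) !ler_pdivrMr// => ez ev.
pose c j := nth 0 (tnth mu z) j - nth 0 (tnth mu v) j.
have cE (j : 'I_p) : c j = tnth (tnth mu z) j - tnth (tnth mu v) j.
  by rewrite /c -!tnth_nth.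
pose A := [set w | \sum_(j < p) c j * (X j w - cmean X Z j z) <= - (2 / 5 * D z v ^+ 2)].
have mA : measurable A.
  apply: measurable_set_ler => //; apply: measurable_sum => j.
  by apply: measurable_funM => //; apply: measurable_funB => //; exact: measurable_funP.
have geo w : rule (Xvec X p w, mu) = v ->
    A w /\ \sum_(j < p) c j ^+ 2 <= 36 / 25 * D z v ^+ 2.
  move=> rv; have := hrule (Xvec X p w) mu z; rewrite rv => near.
  rewrite mulrC in ez; rewrite mulrC in ev.
  have [h1 h2] := nearest_wrong_center near ez ev; split.
    rewrite /A/=; apply: le_trans h1; rewrite le_eqVlt; apply/orP; left; apply/eqP.
    by apply: eq_bigr => j _; rewrite cE !tnth_mktuple.
  apply: le_trans h2; rewrite le_eqVlt; apply/orP; left; apply/eqP.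
  by apply: eq_bigr => j _; rewrite cE.
have s0 : 0 < 9 / D z v ^+ 2 by rewrite divr_gt0// exprn_gt0.
have mB : measurable [set w | Z w = z /\ rule (Xvec X p w, mu) = v].
  apply: measurableI; first exact: measurable_label.
  apply: (measurable_fiber (f := fun w => rule (Xvec X p w, mu))).
  apply: (measurableT_comp (measurable_funP rule)).
  by apply: measurable_fun_pair => //; exact: measurable_Xvec.
have [[w0 Bw0]|nB] := pselect (exists w, rule (Xvec X p w, mu) = v); last first.
  rewrite (_ : [set w | _] = set0) ?measure0 ?lee_fin ?(tail_bound_ge0 Htau)//.
  by rewrite -subset0 => w [_ ?]; apply: nB; exists w.
have cs : \sum_(j < p) c j ^+ 2 <= 9 / D z v ^+ 2 * (2 / 5 * D z v ^+ 2) ^+ 2.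
  have [_ /le_trans] := geo _ Bw0; apply.
  rewrite le_eqVlt; apply/orP; left; apply/eqP; field.
  by rewrite gt_eqF.
have t0 : 0 < 2 / 5 * D z v ^+ 2 by rewrite mulr_gt0// exprn_gt0.
apply: le_trans (Htau z c _ _ t0 s0 cs); rewrite -/A.
apply: le_trans (cond_prob_ge hZ _ mA); apply: le_measure; rewrite ?inE//.
- by apply: measurableI => //; exact: measurable_label.
- by move=> w [Zw rw]; split => //; have [] := geo _ rw.
Qed.

(** The estimated centers are independent of the observation, so they can be
    frozen where both relative errors are small; the rest is paid for by the
    probability that one of them is large. *)
Lemma misclassified_pair_bound tau k z v : tail_bound tau -> 0 < D z v ->
  (Q [set w | obs_z S w k = z /\ substitutes rule mucheck S0 S w k = v] <=
    Q [set w | (10^-1 < rel_error X Z (mucheck (S0 w)) z v)%R] +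
    Q [set w | (10^-1 < rel_error X Z (mucheck (S0 w)) v z)%R] +
    (tau (9 / D z v ^+ 2))%:E)%E.
Proof.
move=> Htau Dzv; have [_ [_ Slaw] SS0] := hdata.
pose O w := tnth (S w) k.
pose M w := mucheck (S0 w).
have mO : measurable_fun setT O by exact: measurable_obs.
have mM : measurable_fun setT M.
  exact: (measurableT_comp (measurable_funP mucheck) (measurable_funP S0)).
have OM : independent Q O M.
  exact: (independent_comp (measurable_tnth k) (measurable_funP mucheck) SS0).
pose good := [set a : K.+1.-tuple (p.-tuple R) |
  rel_error X Z a z v <= 10^-1 /\ rel_error X Z a v z <= 10^-1].
have mgood : measurable good.
  by apply: measurableI; apply: measurable_set_ler => //;
    apply: (measurable_rel_error (f := id)).
pose E := [set ao : K.+1.-tuple (p.-tuple R) * observation R K p |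
  good ao.1 /\ (ao.2.1.2 = z /\ rule (ao.2.1.1, ao.1) = v)].
have mE : measurable E.
  apply: measurableI.
    by rewrite -[X in measurable X]setTI; exact: measurable_fst.
  apply: measurableI.
    apply: (measurable_fiber
      (f := fun ao : K.+1.-tuple (p.-tuple R) * observation R K p => ao.2.1.2)).
    apply: (@measurableT_comp _ _ _ _ _ _ snd) => //.
    exact: (@measurableT_comp _ _ _ _ _ _ fst).
  apply: (measurable_fiber (f := fun ao : K.+1.-tuple (p.-tuple R) *
    observation R K p => rule (ao.2.1.1, ao.1))).
  apply: (measurableT_comp (measurable_funP rule)); apply: measurable_fun_pair => //.
  apply: (@measurableT_comp _ _ _ _ _ _ fst) => //.
  exact: (@measurableT_comp _ _ _ _ _ _ fst).
have s0 : 0 < 9 / D z v ^+ 2 by rewrite divr_gt0// exprn_gt0.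
have QE : (Q [set w | E (M w, O w)] <= (tau (9 / D z v ^+ 2))%:E)%E.
  apply: (independent_section_bound mO mM OM mE) => a.
  have [ga|nga] := pselect (good a); last first.
    rewrite (_ : [set w | _] = set0) ?measure0 ?lee_fin ?(tail_bound_ge0 Htau)//.
    by rewrite -subset0 => w [].
  rewrite (_ : [set w | _] = O @^-1` [set o | o.1.2 = z /\ rule (o.1.1, a) = v]).
    rewrite /O (Slaw k); first by have [g1 g2] := ga; exact: fixed_centers_bound.
    rewrite (_ : [set o | _] = xsection E a); first exact: measurable_xsection.
    by apply/seteqP; split=> o; rewrite /xsection/= inE// => -[].
  by apply/seteqP; split=> w // -[].
have mMO : measurable_fun setT (fun w => (M w, O w)) by exact: measurable_fun_pair.
pose b1 := [set w | 10^-1 < rel_error X Z (mucheck (S0 w)) z v].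
pose b2 := [set w | 10^-1 < rel_error X Z (mucheck (S0 w)) v z].
have mb1 : measurable b1 by exact: measurable_bad.
have mb2 : measurable b2 by exact: measurable_bad.
have mpre : measurable ((fun w => (M w, O w)) @^-1` E).
  by rewrite -[X in measurable X]setTI; exact: mMO.
apply: (@le_trans _ _ (Q (b1 `|` b2 `|` (fun w => (M w, O w)) @^-1` E))).
  apply: le_measure; rewrite ?inE.
  - apply: measurableI; first exact: (measurable_fiber _ (measurable_obs_z k)).
    exact: (measurable_fiber _ (measurable_substitute k)).
  - by do 2 (apply: measurableU => //).
  - move=> w [zw sw].
    have [h1|h1] := ltP (10^-1) (rel_error X Z (mucheck (S0 w)) z v); first by left; left.
    have [h2|h2] := ltP (10^-1) (rel_error X Z (mucheck (S0 w)) v z); first by left; right.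
    by right.
apply: (le_trans (measureU2 _ _ _)) => //; first exact: measurableU.
by rewrite leeD// measureU2.
Qed.

(** One value for all observations of a sample, so that averages over the sample
    can be bounded by it as well. *)
Definition misclassification_bound (tau : R -> R) : \bar R :=
  (\sum_(zv : 'I_K.+1 * 'I_K.+1 | zv.1 != zv.2)
    (Q [set w | (10^-1 < rel_error X Z (mucheck (S0 w)) zv.1 zv.2)%R] +
     Q [set w | (10^-1 < rel_error X Z (mucheck (S0 w)) zv.2 zv.1)%R] +
     (tau (9 / D zv.1 zv.2 ^+ 2))%:E))%E.

Lemma measurable_misclassified k :
  measurable [set w | substitutes rule mucheck S0 S w k <> obs_z S w k].
Proof.
rewrite (_ : [set w | _] = ~` \big[setU/set0]_(z : 'I_K.+1)
   ([set w | substitutes rule mucheck S0 S w k = z] `&` [set w | obs_z S w k = z])).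
  apply: measurableC; apply: bigsetU_measurable => z _; apply: measurableI.
    exact: (measurable_fiber _ (measurable_substitute k)).
  exact: (measurable_fiber _ (measurable_obs_z k)).
apply/seteqP; split => w /=.
  by move=> h; rewrite -bigcup_seq => -[z _ [/= h1 h2]]; apply: h; rewrite h1 h2.
move=> h e; apply: h; rewrite (bigD1 (obs_z S w k))//=; left.
by split.
Qed.

Lemma misclassification_boundP tau k : tail_bound tau ->
  (forall z v, z != v -> 0 < D z v) ->
  (Q [set w | substitutes rule mucheck S0 S w k <> obs_z S w k] <=
    misclassification_bound tau)%E.
Proof.
move=> Htau HD.
apply: (measure_union_bound (F := fun zv : 'I_K.+1 * 'I_K.+1 =>
  [set w | obs_z S w k = zv.1 /\ substitutes rule mucheck S0 S w k = zv.2])).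
- exact: measurable_misclassified.
- move=> zv; apply: measurableI.
    exact: (measurable_fiber _ (measurable_obs_z k)).
  exact: (measurable_fiber _ (measurable_substitute k)).
- move=> w /= h; exists (obs_z S w k, substitutes rule mucheck S0 S w k) => //=.
  by apply/eqP => e; apply: h.
- by move=> zv zv12; apply: misclassified_pair_bound => //; exact: HD.
Qed.

End misclassification.

(** * Regression within labels *)

Section within_labels.
Context (R : realType) (K n : nat).
Implicit Types (x y u : 'I_n -> R) (c : 'I_n -> 'I_K.+1).

(** Normalized by the size of the sample and not of the class: this makes it a
    sample mean, to which the law of large numbers applies. *)
Definition class_mean c u z : R := n%:R^-1 * \sum_(k < n) u k * (c k == z)%:R.

Lemma class_meanE c u z : class_mean c u z = n%:R^-1 * \sum_(k < n | c k == z) u k.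
Proof.
rewrite /class_mean [in RHS]big_mkcond/=; congr (_ * _); apply: eq_bigr => k _.
by case: eqP; rewrite ?mulr1 ?mulr0.
Qed.

(** After division by the sample size, a within-label sum of products is a
    continuous function of sample means. An empty class contributes nothing on
    either side, since [0^-1 = 0]. *)
Lemma within_cov_class_mean c x y : (0 < n)%N ->
  n%:R^-1 * within_cov c x y = n%:R^-1 * (\sum_(k < n) x k * y k) -
    \sum_z (class_mean c (fun=> 1) z)^-1 * (class_mean c x z * class_mean c y z).
Proof.
move=> n0; have n0' : n%:R != 0 :> R by rewrite pnatr_eq0 -lt0n.
rewrite /within_cov (partition_big c xpredT)//=.
rewrite [X in _ = _ * X - _](partition_big c xpredT)//= !mulr_sumr -sumrB.
apply: eq_bigr => z _.
transitivity (n%:R^-1 * (\sum_(k < n | c k == z)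
    (x k - label_mean c x z) * (y k - label_mean c y z))).
  by congr (_ * _); apply: eq_bigr => k /eqP ->.
rewrite !class_meanE /label_mean.
have -> : \sum_(k < n | c k == z) (1 : R) = #|[set k | c k == z]%SET|%:R.
  by rewrite -[in RHS]sum1_card natr_sum; apply: eq_bigl => k; rewrite inE.
set N : R := #|[set k | c k == z]%SET|%:R.
set Sx := \sum_(k < n | c k == z) x k; set Sy := \sum_(k < n | c k == z) y k.
set Sxy := \sum_(k < n | c k == z) x k * y k.
have -> : \sum_(k < n | c k == z) (x k - N^-1 * Sx) * (y k - N^-1 * Sy) =
    Sxy - N^-1 * Sx * Sy - N^-1 * Sy * Sx + N * (N^-1 * Sx * (N^-1 * Sy)).
  have -> : N * (N^-1 * Sx * (N^-1 * Sy)) =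
      \sum_(k < n | c k == z) N^-1 * Sx * (N^-1 * Sy).
    rewrite /N -sum1_card natr_sum mulr_suml.
    by apply: eq_big => k; rewrite ?inE// mul1r.
  rewrite /Sxy [in RHS]mulr_sumr [in X in _ - X + _]mulr_sumr -!sumrB -big_split/=.
  by apply: eq_bigr => k _; ring.
have [N0|N0] := eqVneq N 0.
  have Sxy0 : Sxy = 0.
    rewrite /Sxy big_pred0// => k; apply/negbTE/negP => ck.
    move/eqP: N0; rewrite /N pnatr_eq0 cards_eq0 => /eqP/setP/(_ k).
    by rewrite !inE ck.
  by rewrite N0 Sxy0 !(invr0, mul0r, mulr0, subr0, addr0).
by field; rewrite N0 n0'.
Qed.

Lemma within_varE c x : within_var c x = within_cov c x x.
Proof. by apply: eq_bigr => k _; rewrite expr2. Qed.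

Lemma class_mean_perturb c c' u z :
  `|class_mean c' u z - class_mean c u z| <=
    n%:R^-1 * \sum_(k < n) `|u k| * (c' k != c k)%:R.
Proof.
rewrite /class_mean -mulrBr -sumrB normrM ger0_norm ?invr_ge0//.
rewrite ler_wpM2l ?invr_ge0// (le_trans (ler_norm_sum _ _ _))// ler_sum// => k _.
rewrite -mulrBr normrM ler_wpM2l//.
have [->|ne] := eqVneq (c' k) (c k); first by rewrite subrr normr0.
by case: (c' k == z); case: (c k == z); rewrite ?subrr ?subr0 ?sub0r ?normrN ?normr1 ?normr0.
Qed.

End within_labels.

(** * Averages over misclassified observations *)

Section misclassified_mean.
Context d0 (T0 : measurableType d0) (R : realType) (P : probability T0 R).
Variable W0 : T0 -> R.
Hypothesis iW0 : P.-integrable setT (EFin \o W0).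

(** Where [W] is at most [M] in absolute value the event costs [M] times its
    probability, elsewhere the tail of [W0] costs [e]. As [W] may
    depend on the event, this replaces a product rule. *)
Lemma integral_on_rare_event d (T : measurableType d) (Q : probability T R)
    (W : T -> R) (A : set T) (M e : R) (b : \bar R) :
  0 <= M -> measurable_fun setT W -> same_law Q W P W0 -> measurable A ->
  (\int[P]_x (`|W0 x| * (M < `|W0 x|)%R%:R)%:E <= e%:E)%E ->
  (Q A <= b)%E ->
  (\int[Q]_w (`|W w| * \1_A w)%:E <= M%:E * b + e%:E)%E.
Proof.
move=> M0 mW WW0 mA We Ab.
have mW0 := integrable_measurable iW0.
pose g (y : R) : R := `|y| * (M < `|y|)%R%:R.
have mg : measurable_fun setT g.
  apply: measurable_funM => //.
  by apply: measurable_exceedance; exact: normr_measurable.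
have g0 y : 0 <= g y by rewrite mulr_ge0.
have eg : (\int[Q]_w (g (W w))%:E = \int[P]_w (g (W0 w))%:E)%E.
  apply: (ge0_integral_same_law (f := EFin \o g) mW mW0 WW0).
    exact/measurable_EFinP.
  by move=> y; rewrite /= lee_fin.
have mMA : measurable_fun setT (fun w => M * \1_A w) by exact: measurable_funM.
have mgW : measurable_fun setT (g \o W) by exact: measurableT_comp.
apply: (@le_trans _ _ (\int[Q]_w ((M * \1_A w)%:E + (g (W w))%:E))%E).
  apply: ge0_le_integral => //.
  - by apply/measurable_EFinP; apply: measurable_funM => //; exact: measurableT_comp.
  - by apply: emeasurable_funD; apply/measurable_EFinP.
  - move=> w _; rewrite -EFinD lee_fin /g indicE.
    case: (w \in A); rewrite ?mulr1 ?mulr0 ?add0r ?mulr_ge0//.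
    by case: ltP => h; rewrite ?mulr1 ?mulr0 ?addr0// lerDr.
rewrite ge0_integralD//; last 4 first.
- by move=> w _; rewrite lee_fin mulr_ge0.
- exact/measurable_EFinP.
- by move=> w _; rewrite lee_fin.
- exact/measurable_EFinP.
rewrite eg leeD//.
under eq_integral do rewrite EFinM.
rewrite ge0_integralZl//.
  by rewrite integral_indic// setIT lee_wpmul2l// lee_fin.
by apply/measurable_EFinP.
Qed.

(** The variables have one law, so a single truncation level serves all of them;
    with a uniform bound on the probabilities of the events the mean tends to
    zero in L1. *)
Lemma misclassified_mean_whp (d : nat -> measure_display)
    (Om : forall r, measurableType (d r)) (Q : forall r, probability (Om r) R)
    (n : nat -> nat) (W : forall r, 'I_(n r) -> Om r -> R)
    (A : forall r, 'I_(n r) -> set (Om r)) (err : nat -> \bar R) :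
  (forall r k, measurable_fun setT (W r k)) ->
  (forall r k, same_law (Q r) (W r k) P W0) ->
  (forall r k, measurable (A r k)) ->
  (\forall r \near \oo, forall k, (Q r (A r k) <= err r)%E) ->
  err r @[r --> \oo] --> 0%E ->
  onS (fun r w => (n r)%:R^-1 * \sum_(k < n r) `|W r k w| * \1_(A r k) w) @ whp Q
    --> (0 : R).
Proof.
move=> mW WW0 mA Aerr err0.
have mWA r k : measurable_fun setT (fun w => `|W r k w| * \1_(A r k) w).
  by apply: measurable_funM => //; exact: measurableT_comp.
have WA0 r k w : 0 <= `|W r k w| * \1_(A r k) w by rewrite mulr_ge0.
apply: cvg_L1_whp => [r|].
  by apply: measurable_funM => //; apply: measurable_sum.
apply: cvge0P => [r|e e0]; first by apply: integral_ge0 => x _; rewrite lee_fin.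
have e2 : 0 < e / 2 by rewrite divr_gt0.
have [M M0 We] := truncation iW0 e2.
have eM : 0 < e / 2 / M by rewrite divr_gt0.
near=> r.
have n0 : (0 <= (n r)%:R^-1 :> R) by rewrite invr_ge0.
under eq_integral.
  move=> w _; rewrite ger0_norm; last by rewrite mulr_ge0// sumr_ge0.
  rewrite EFinM -sumEFin; over.
rewrite ge0_integralZl//; last 2 first.
- apply: emeasurable_sum => k; exact/measurable_EFinP.
- by move=> w _; apply: sume_ge0 => k _; rewrite lee_fin.
rewrite ge0_integral_sum//; last by move=> k; exact/measurable_EFinP.
apply: (@le_trans _ _ ((n r)%:R^-1%:E * \sum_(k < n r) e%:E)%E).
  rewrite lee_wpmul2l ?lee_fin//; apply: lee_sum => k _.
  have errM : (Q r (A r k) <= (e / 2 / M)%:E)%E.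
    apply: (@le_trans _ _ (err r)).
      by have : forall k, (Q r (A r k) <= err r)%E by near: r.
    by apply: ltW; near: r; exact: cvge0_near_lt err0 eM.
  apply: (le_trans (integral_on_rare_event (ltW M0) (mW r k) (WW0 r k) (mA r k) We errM)).
  by rewrite -EFinM -EFinD lee_fin mulrC divfK ?gt_eqF// -splitr.
rewrite sumEFin -EFinM lee_fin sumr_const card_ord -[e *+ _]mulr_natl.
have [->|nr] := eqVneq (n r) 0%N; first by rewrite mul0r mulr0 ltW.
by rewrite mulKf// pnatr_eq0.
Unshelve. all: by end_near. Qed.

End misclassified_mean.

(** * Conditional moments given the label *)

Section population.
Context d (Om : measurableType d) (R : realType) (P : probability Om R)
  (K : nat) (Z : {RV P >-> 'I_K.+1}).
Hypothesis hZ : forall z, (0 < P (Z @^-1` [set z]))%E.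
Notation pz := (label_prob Z).

Definition label_indic z w : R := (Z w == z)%:R.

Lemma label_indicE z : label_indic z = \1_(Z @^-1` [set z]).
Proof.
apply/funext => w; rewrite /label_indic indicE; congr (nat_of_bool _)%:R.
by apply/eqP/idP; rewrite inE.
Qed.

Lemma measurable_label_indic z : measurable_fun setT (label_indic z).
Proof. by rewrite label_indicE; apply: measurable_indic; exact: measurable_label. Qed.

Lemma sum_label_indic (g : 'I_K.+1 -> R) w : \sum_z g z * label_indic z w = g (Z w).
Proof.
rewrite (bigD1 (Z w))//= /label_indic eqxx mulr1 big1 ?addr0// => z.
by rewrite eq_sym => /negbTE ->; rewrite mulr0.
Qed.

Lemma ge0_integral_cond z (f : Om -> \bar R) : measurable_fun setT f ->
  (forall w, (0 <= f w)%E) ->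
  (\int[cond_prob Z z]_w f w = \int[P]_w (((pz z)^-1 * label_indic z w)%:E * f w))%E.
Proof.
move=> mf f0.
apply: (@ge0_integral_density _ _ _ _ R P (cond_prob Z z) id) => //.
- by apply: measurable_funM => //; exact: measurable_label_indic.
- by move=> w; rewrite mulr_ge0// invr_ge0 ltW// label_prob_gt0.
- move=> A mA; apply: (etrans (cond_probE hZ z A)); rewrite preimage_id.
  under eq_integral do rewrite EFinM label_indicE.
  rewrite ge0_integralZl//; last 2 first.
  + by apply/measurable_EFinP; apply: measurable_indic; exact: measurable_label.
  + by rewrite lee_fin invr_ge0 ltW// label_prob_gt0.
  by rewrite integral_indic//; [rewrite muleC setIC|exact: measurable_label].
Qed.

Lemma integrable_label_indic z U : P.-integrable setT (EFin \o U) ->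
  P.-integrable setT (EFin \o (fun w => U w * label_indic z w)).
Proof.
move=> iU; have mU := integrable_measurable iU; apply: integrable_le iU.
  apply: measurable_funM => //; exact: measurable_label_indic.
by move=> w; rewrite normrM normr_nat ler_piMr// lern1 leq_b1.
Qed.

Lemma cond_integrable z U : P.-integrable setT (EFin \o U) ->
  (cond_prob Z z).-integrable setT (EFin \o U).
Proof.
move=> iU; have mU := integrable_measurable iU.
have mU' : measurable_fun setT (fun w => `|U w|%:E).
  by apply/measurable_EFinP; exact: measurableT_comp.
apply/integrableP; split; first exact/measurable_EFinP.
rewrite ge0_integral_cond//.
have /integrableP[_] := integrable_mulr (pz z)^-1 (integrable_label_indic z (integrable_norm iU)).
apply: le_lt_trans; rewrite le_eqVlt; apply/orP; left; apply/eqP.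
apply: eq_integral => w _; rewrite /= -EFinM; congr EFin.
rewrite [RHS]ger0_norm; first by ring.
by rewrite mulr_ge0 ?invr_ge0 ?mulr_ge0// ltW// label_prob_gt0.
Qed.

Lemma cond_Rintegral z U : P.-integrable setT (EFin \o U) ->
  \int[cond_prob Z z]_w U w = (pz z)^-1 * \int[P]_w (U w * label_indic z w).
Proof.
move=> iU; have mU := integrable_measurable iU.
pose p (y : R) : R := Num.max y 0%R.
pose q (y : R) : R := Num.max (- y)%R 0%R.
have mp : measurable_fun setT p by apply: measurable_maxr.
have mq : measurable_fun setT q by apply: measurable_maxr.
have p0 y : (0 <= p y)%R by rewrite le_max lexx orbT.
have q0 y : (0 <= q y)%R by rewrite le_max lexx orbT.
have pn y : (p y <= `|y|)%R by rewrite ge_max ler_norm normr_ge0.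
have qn y : (q y <= `|y|)%R by rewrite ge_max -normrN ler_norm normr_ge0.
have pq y : (y = p y - q y)%R.
  by rewrite /p /q; case: (lerP y 0) => y0; case: (lerP (-y) 0); lra.
have ih (h : R -> R) : (forall y, 0 <= h y) -> (forall y, h y <= `|y|) ->
    measurable_fun setT h -> P.-integrable setT (EFin \o (h \o U)).
  move=> h0 hn mh; apply: integrable_le iU; first exact: measurableT_comp.
  by move=> w /=; rewrite ger0_norm.
have step (h : R -> R) : (forall y, 0 <= h y) -> (forall y, h y <= `|y|) ->
    measurable_fun setT h ->
    \int[cond_prob Z z]_w h (U w) = (pz z)^-1 * \int[P]_w (h (U w) * label_indic z w).
  move=> h0 hn mh; have ihU := ih h h0 hn mh.
  rewrite -RintegralZl//; last exact: (integrable_label_indic z ihU).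
  rewrite /Rintegral ge0_integral_cond//; last by move=> w; rewrite lee_fin.
    by congr fine; apply: eq_integral => w _; rewrite -EFinM; congr EFin; ring.
  by apply/measurable_EFinP; exact: measurableT_comp.
have -> : \int[cond_prob Z z]_w U w =
    \int[cond_prob Z z]_w (p (U w) - q (U w)).
  by apply: eq_Rintegral => w _; exact: pq.
rewrite RintegralB//; last 2 first.
  exact: cond_integrable (ih _ p0 pn mp).
  exact: cond_integrable (ih _ q0 qn mq).
rewrite !step// -mulrBr -RintegralB//; last 2 first.
  exact: (integrable_label_indic z (ih _ p0 pn mp)).
  exact: (integrable_label_indic z (ih _ q0 qn mq)).
congr (_ * _); apply: eq_Rintegral => w _.
by rewrite -mulrBl -pq.
Qed.

Lemma Rintegral_label (g : 'I_K.+1 -> R) :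
  \int[P]_w g (Z w) = \sum_z g z * pz z.
Proof.
have il z : P.-integrable setT (EFin \o label_indic z).
  have := integrable_label_indic z (integrable_cst P 1).
  by under [fun w => 1 * _]eq_fun do rewrite mul1r.
have -> : \int[P]_w g (Z w) = \int[P]_w (\sum_z g z * label_indic z w).
  by apply: eq_Rintegral => w _; rewrite sum_label_indic.
rewrite Rintegral_sum => [|z]; last exact: integrable_mulr.
apply: eq_bigr => z _; rewrite RintegralZl//; congr (_ * _).
rewrite /Rintegral label_indicE integral_indic//; last exact: measurable_label.
by rewrite setIT.
Qed.

(** The limit of the normalized within-label sums of products, for latent and
    for substitute labels, in the form in which it arises from class means;
    [within_covarianceE] identifies it as the mean conditional covariance. *)
Definition within_covariance (U V : Om -> R) : R :=
  \int[P]_w (U w * V w) - \sum_z (pz z)^-1 *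
    (\int[P]_w (U w * label_indic z w) * \int[P]_w (V w * label_indic z w)).

Definition square_integrable_rv (U : Om -> R) :=
  measurable_fun setT U /\ P.-integrable setT (EFin \o (fun w => U w ^+ 2)).

Lemma cond_covarianceE z U V : square_integrable_rv U -> square_integrable_rv V ->
  fine (covariance (cond_prob Z z) U V) =
  (pz z)^-1 * \int[P]_w (U w * V w * label_indic z w) -
  (pz z)^-1 ^+ 2 * (\int[P]_w (U w * label_indic z w) * \int[P]_w (V w * label_indic z w)).
Proof.
move=> [mU iU2] [mV iV2].
have iU := square_integrable mU iU2; have iV := square_integrable mV iV2.
have iUV := square_integrableM mU mV iU2 iV2.
pose Pc := cond_prob Z z.
pose a := fine ('E_Pc[U])%E; pose b := fine ('E_Pc[V])%E.
rewrite covariance.unlock -/Pc -/a -/b.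
have aE : a = (pz z)^-1 * \int[P]_w (U w * label_indic z w).
  by rewrite -cond_Rintegral// /a expectation.unlock.
have bE : b = (pz z)^-1 * \int[P]_w (V w * label_indic z w).
  by rewrite -cond_Rintegral// /b expectation.unlock.
transitivity (\int[Pc]_w ((U w * V w - a * V w) - (b * U w - a * b))).
  rewrite expectation.unlock /Rintegral; congr fine; apply: eq_integral => w _ /=.
  by congr EFin; rewrite /cst; change ((U w - a) * (V w - b) = U w * V w - a * V w - (b * U w - a * b)); ring.
have cU := cond_integrable z iU; have cV := cond_integrable z iV.
have cUV := cond_integrable z iUV.
have caV := integrable_mulr a cV; have cbU := integrable_mulr b cU.
rewrite RintegralB//; last 2 first.
  exact: integrable_subr.
  by apply: integrable_subr => //; exact: integrable_cst.
rewrite RintegralB// RintegralB//; last exact: integrable_cst.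
rewrite [X in _ - (_ - X)](Rintegral_cst1 Pc (a * b)) !RintegralZl//.
by rewrite !cond_Rintegral// aE bE; ring.
Qed.

Lemma within_covarianceE U V : square_integrable_rv U -> square_integrable_rv V ->
  fine ('E_P[fun w => fine (covariance (cond_prob Z (Z w)) U V)])%E =
  within_covariance U V.
Proof.
move=> sU sV; have [[mU iU2] [mV iV2]] := (sU, sV).
have iUV := square_integrableM mU mV iU2 iV2.
rewrite unlock.
apply: (etrans (Rintegral_label (fun z => fine (covariance (cond_prob Z z) U V)))).
rewrite /within_covariance.
have -> : \int[P]_w (U w * V w) = \sum_z \int[P]_w (U w * V w * label_indic z w).
  rewrite -Rintegral_sum => [|z]; last exact: integrable_label_indic.
  by apply: eq_Rintegral => w _; rewrite (sum_label_indic (fun=> U w * V w)).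
rewrite -sumrB; apply: eq_bigr => z _; rewrite cond_covarianceE//.
have : pz z != 0 by rewrite gt_eqF// label_prob_gt0.
by move=> pz0; field.
Qed.

End population.

(** * The mixture model *)

Section mixture.
Context d (Om : measurableType d) (R : realType) (P : probability Om R)
  (K : nat) (X : nat -> {RV P >-> R}) (Z : {RV P >-> 'I_K.+1}).
Hypothesis hmix : mixture_model X Z.

Lemma mixture_label_gt0 z : (0 < P (Z @^-1` [set z]))%E.
Proof. by have [_ _ _ _] := hmix; apply. Qed.

Lemma cond_square_integrable j z :
  (cond_prob Z z).-integrable setT (EFin \o (fun w => X j w ^+ 2)).
Proof.
have [_ /(_ j z) + _ _ _] := hmix; rewrite unlock => h.
apply/integrableP; split.
  by apply/measurable_EFinP; apply: measurable_funX; exact: measurable_funP.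
under eq_integral do rewrite /= ger0_norm ?sqr_ge0//.
exact: h.
Qed.

(** The model bounds second moments given each label, and there are finitely many
    labels. *)
Lemma mixture_square_integrable j : square_integrable_rv P (X j).
Proof.
have mX : measurable_fun setT (X j) by exact: measurable_funP.
have mX2 : measurable_fun setT (fun w => X j w ^+ 2) by exact: measurable_funX.
split=> //; apply/integrableP; split; first exact/measurable_EFinP.
under eq_integral do rewrite /= ger0_norm ?sqr_ge0//.
have -> : (\int[P]_w (X j w ^+ 2)%:E =
    \sum_z \int[P]_w (X j w ^+ 2 * label_indic Z z w)%:E)%E.
  rewrite -ge0_integral_sum//.
  - apply: eq_integral => w _; rewrite sumEFin.
    by rewrite (sum_label_indic Z (fun=> X j w ^+ 2)).
  - move=> z; apply/measurable_EFinP; apply: measurable_funM => //.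
    exact: measurable_label_indic.
  - by move=> z w _; rewrite lee_fin mulr_ge0 ?sqr_ge0.
apply: lte_sum_pinfty => z _.
have pz0 := label_prob_gt0 mixture_label_gt0 z.
have -> : (\int[P]_w (X j w ^+ 2 * label_indic Z z w)%:E =
    (label_prob Z z)%:E * \int[cond_prob Z z]_w (X j w ^+ 2)%:E)%E.
  rewrite (ge0_integral_cond mixture_label_gt0); last 2 first.
  - exact/measurable_EFinP.
  - by move=> w; rewrite lee_fin sqr_ge0.
  rewrite -ge0_integralZl//; last 3 first.
  - apply/measurable_EFinP; apply: measurable_funM => //.
    by apply: measurable_funM => //; exact: measurable_label_indic.
  - by move=> w _; rewrite lee_fin mulr_ge0 ?sqr_ge0// mulr_ge0// invr_ge0 ltW.
  - by rewrite lee_fin ltW.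
  apply: eq_integral => w _; rewrite -!EFinM; congr EFin.
  by field; rewrite gt_eqF.
rewrite lte_mul_pinfty// ?lee_fin ?(ltW pz0)//.
have /integrableP[_] := cond_square_integrable j z.
by under eq_integral do rewrite /= ger0_norm ?sqr_ge0//.
Qed.

Lemma cmeanE j z : cmean X Z j z = \int[cond_prob Z z]_w X j w.
Proof. by rewrite /cmean unlock. Qed.

Lemma cvarE j z :
  cvar X Z j z = \int[cond_prob Z z]_w ((X j w - cmean X Z j z) ^+ 2).
Proof.
rewrite /cvar /variance covariance.unlock -/(cmean X Z j z).
by rewrite expectation.unlock; congr fine; apply: eq_integral => w _; rewrite expr2.
Qed.

Lemma chebyshev_tail_bound p (smax2 : R) : (forall j z, cvar X Z j z <= smax2) ->
  0 <= smax2 -> tail_bound X Z p (fun s => smax2 * s).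
Proof.
move=> cv s20 z c t s t0 s0 cs; have [iX _ _ _ _] := hmix.
have := @chebyshev_tail _ _ R (cond_prob Z z) (fun j => X j : Om -> R) p c t s
  (fun j => measurable_funP (X j)) (iX z) t0 cs smax2 s20
  (fun j => cond_square_integrable j z) _.
under eq_set => w do under eq_bigr do rewrite -cmeanE.
by apply=> j; rewrite -cmeanE -cvarE.
Qed.

(** The maximum with 1 makes the variance factor positive, as the Chernoff bound
    divides by it. *)
Lemma subgaussian_tail_bound p (v : R) : (forall j z, subgaussian X Z v j z) ->
  tail_bound X Z p (fun s => expR (- (2 * Num.max v 1 * s)^-1)).
Proof.
move=> sg z c t s t0 s0 cs; have [iX _ _ _ _] := hmix.
have v0 : 0 < Num.max v 1 by rewrite lt_max ltr01 orbT.
have := @subgaussian_tail _ _ R (cond_prob Z z) (fun j => X j : Om -> R) p c t s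
  (fun j => measurable_funP (X j)) (iX z) t0 s0 cs (Num.max v 1) v0.
under eq_set => w do under eq_bigr do rewrite -cmeanE.
apply=> l j; rewrite -cmeanE.
have mE : measurable_fun setT (fun w => expR (l * (X j w - cmean X Z j z))).
  apply: measurableT_comp => //; apply: measurable_funM => //.
  by apply: measurable_funB => //; exact: measurable_funP.
have E0 w : (0 <= (expR (l * (X j w - cmean X Z j z)))%:E)%E.
  by rewrite lee_fin expR_ge0.
have bnd : (\int[cond_prob Z z]_w (expR (l * (X j w - cmean X Z j z)))%:E <=
    (expR (2^-1 * l ^+ 2 * Num.max v 1))%:E)%E.
  apply: (@le_trans _ _ (expeR (2^-1 * l ^+ 2 * v)%:E)).
    have := sg j z l; rewrite expectation.unlock -lee_expeR.
    by rewrite lneK// in_itv/= leey andbT integral_ge0.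
  rewrite /= lee_fin ler_expR ler_wpM2l ?le_max ?lexx//.
  by rewrite mulr_ge0 ?sqr_ge0// invr_ge0.
have iE : (cond_prob Z z).-integrable setT
    (EFin \o (fun w => expR (l * (X j w - cmean X Z j z)))).
  apply/integrableP; split; first exact/measurable_EFinP.
  under eq_integral do rewrite /= ger0_norm ?expR_ge0//.
  by rewrite (le_lt_trans bnd) ?ltry.
by split => //; rewrite -lee_fin -integral_EFin.
Qed.

Lemma sep_le p z v : z != v ->
  (sep X Z p <= (l2dist (muvec X Z p z) (muvec X Z p v) ^+ 2)%:E)%E.
Proof.
move=> zv; rewrite /sep (bigD1 (z, v))//=.
by rewrite ge_min lexx.
Qed.

(** The squared distances are partial sums of the divergent series of squared
    mean differences. *)
Lemma centers_diverge (p : nat -> nat) z v : p r @[r --> \oo] --> \oo -> z != v ->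
  l2dist (muvec X Z (p r) z) (muvec X Z (p r) v) ^+ 2 @[r --> \oo] --> +oo.
Proof.
move=> hp zv; have [_ _ /(_ v z zv) hsum _ _] := hmix.
pose f j : R := (cmean X Z j v - cmean X Z j z) ^+ 2.
have f0 j : (0 <= (f j)%:E)%E by rewrite lee_fin sqr_ge0.
have cvf : (\sum_(0 <= j < q) (f j)%:E)%E @[q --> \oo] --> +oo%E.
  have := is_cvg_nneseries (fun j (_ : (0 <= j)%N) (_ : true) => f0 j).
  move=> h.
  have {}h : (\sum_(0 <= j < q) (f j)%:E)%E @[q --> \oo] -->
      (\sum_(0 <= j <oo) ((cmean X Z j v - cmean X Z j z) ^+ 2)%:E)%E := h.
  by rewrite hsum in h.
have cvp : (\sum_(0 <= j < p r) (f j)%:E)%E @[r --> \oo] --> +oo%E.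
  exact: (cvg_comp p (fun q => (\sum_(0 <= j < q) (f j)%:E)%E) hp cvf).
apply/cvgryPge => A.
have /cvgeyPge /(_ A) := cvp; apply: filterS => r.
rewrite sumEFin lee_fin l2dist_sqr big_mkord => /le_trans; apply.
rewrite le_eqVlt; apply/orP; left; apply/eqP.
by apply: eq_bigr => j _; rewrite !tnth_mktuple /f -sqrrN opprB.
Qed.

End mixture.

(** * Asymptotics of the two regressions *)

Lemma cvgry_gt0 (R : realType) (f : nat -> R) :
  f r @[r --> \oo] --> +oo -> \forall r \near \oo, 0 < f r.
Proof. by move=> /cvgryPgt; apply. Qed.

Section asymptotics.
Context (R : realType) (d0 : measure_display) (Om0 : measurableType d0)
  (P : probability Om0 R) (K : nat) (X : nat -> {RV P >-> R}) (Y : {RV P >-> R})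
  (Z : {RV P >-> 'I_K.+1}).
Hypotheses (hY : ('E_P[(fun w => Y w ^+ 2)%R] < +oo)%E) (hmix : mixture_model X Z).
Context (i : nat) (n m p : nat -> nat).
Hypotheses (hn : n r @[r --> \oo] --> \oo) (hp : p r @[r --> \oo] --> \oo)
  (hip : forall r, (i < p r)%N).
Context (d : nat -> measure_display) (Om : forall r, measurableType (d r))
  (Q : forall r, probability (Om r) R)
  (S0 : forall r, {RV (Q r) >-> (m r).-tuple ((p r).-tuple R)})
  (S : forall r, {RV (Q r) >-> (n r).-tuple (observation R K (p r))}).
Hypothesis hdata : forall r, sampling X Y Z (S0 r) (S r).
Context (mucheck : forall r, {mfun (m r).-tuple ((p r).-tuple R) >->
                                   K.+1.-tuple ((p r).-tuple R)})
  (rule : forall r, {mfun ((p r).-tuple R * K.+1.-tuple ((p r).-tuple R))%type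
                          >-> 'I_K.+1}).
Hypothesis hrule : forall r, is_nearest_rule (rule r).

Let hZ := mixture_label_gt0 hmix.
Local Notation D r z v := (l2dist (muvec X Z (p r) z) (muvec X Z (p r) v)).
Local Notation x r w k := (tnth (obs_x (S r) w k) (Ordinal (hip r))).
Local Notation y r w k := (obs_y (S r) w k).
Local Notation zl r w := (obs_z (S r) w).
Local Notation zh r w := (substitutes (rule r) (mucheck r) (S0 r) (S r) w).
Local Notation miss r k := [set w : Om r | zh r w k <> zl r w k].
Local Notation bad r z v := [set w : Om r | 10^-1 < rel_error X Z (mucheck r (S0 r w)) z v].

(** The factor [a] is 1 for consistency, and the sample size for the recovery of
    all labels at once. *)
Lemma misclassification_bound_cvg (a : nat -> R) (tau : R -> R) :
  (forall r, 0 <= a r) ->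
  (forall s, 0 <= s -> 0 <= tau s) ->
  (forall z v, v != z -> ((a r)%:E * Q r (bad r z v))%E @[r --> \oo] --> 0%E) ->
  (forall z v, z != v -> a r * tau (9 / D r z v ^+ 2) @[r --> \oo] --> 0) ->
  ((a r)%:E * misclassification_bound X Z (S0 r) (mucheck r) tau)%E @[r --> \oo]
    --> 0%E.
Proof.
move=> a0 tau_ge0 hbad htau.
have tau0 r z v : 0 <= tau (9 / D r z v ^+ 2) by rewrite tau_ge0// divr_ge0// sqr_ge0.
rewrite (_ : (fun r => _) = (fun r => \sum_(zv : 'I_K.+1 * 'I_K.+1 | zv.1 != zv.2)
    ((a r)%:E * Q r (bad r zv.1 zv.2) + (a r)%:E * Q r (bad r zv.2 zv.1) +
     (a r * tau (9 / D r zv.1 zv.2 ^+ 2))%:E))%E); last first.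
  apply/funext => r; rewrite /misclassification_bound ge0_sume_distrr; last first.
    by move=> zv _; rewrite !adde_ge0 ?lee_fin.
  apply: eq_bigr => zv _.
  by rewrite ge0_muleDr ?adde_ge0 ?lee_fin// ge0_muleDr.
rewrite [X in _ --> X](_ : _ = (\sum_(zv : 'I_K.+1 * 'I_K.+1 | zv.1 != zv.2) 0)%E);
  last by rewrite big1.
apply: cvg_nnesum => -[z v] /= zv.
  by apply: nearW => r; rewrite !adde_ge0 ?mule_ge0 ?lee_fin ?mulr_ge0.
rewrite -[X in _ --> X]adde0; apply: cvgeD => //.
  rewrite -[X in _ --> X]adde0; apply: cvgeD => //; apply: hbad => //.
  by rewrite eq_sym.
by apply/fine_cvgP; split; [exact: nearW|exact: htau].
Qed.

Lemma centers_separate : \forall r \near \oo, forall z v, z != v -> 0 < D r z v.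
Proof.
apply: filter_forall => z; apply: filter_forall => v.
have [->|zv] := eqVneq z v; first by apply: nearW.
have := cvgry_gt0 (centers_diverge hmix hp zv); apply: filterS => r Dr _.
rewrite lt_neqAle eq_sym sqrtr_ge0 andbT.
by apply: contraTneq Dr; move=> ->; rewrite expr0n ltxx.
Qed.

Lemma misclassified_near (tau : R -> R) :
  (forall r, tail_bound X Z (p r) tau) ->
  \forall r \near \oo, forall k,
    (Q r (miss r k) <= misclassification_bound X Z (S0 r) (mucheck r) tau)%E.
Proof.
move=> htau; apply: filterS centers_separate => r hD k.
exact: (misclassification_boundP hZ (hdata r) (mucheck r) (@hrule r) k (@htau r) hD).
Qed.

(** A union bound over the sample, hence the factor [n r]. *)
Lemma all_labels_recovered (tau : R -> R) :
  (forall r, tail_bound X Z (p r) tau) ->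
  ((n r)%:R%:E * misclassification_bound X Z (S0 r) (mucheck r) tau)%E
    @[r --> \oo] --> 0%E ->
  \forall u \near whp Q, zh (projT1 u) (projT2 u) = zl (projT1 u) (projT2 u).
Proof.
move=> htau bnd0.
have mmiss r k : measurable (miss r k).
  exact: (measurable_misclassified (S0 r) (S r) (mucheck r) (rule r) k).
pose B r := \big[setU/set0]_(k < n r) (miss r k).
exists B; last first.
  move=> r w /= h; apply: contrapT => nB; apply: h; apply/funext => k.
  by apply: contrapT => hk; apply: nB; rewrite /B (bigD1 k)//=; left.
split; first by move=> r; apply: bigsetU_measurable.
apply: (cvge0_sup _ _ bnd0); apply: filterS (misclassified_near htau) => r hr.
rewrite measure_ge0 /=.
apply: (@le_trans _ _ (\sum_(k < n r) misclassification_bound X Z (S0 r) (mucheck r) tau)%E).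
  apply: (measure_union_bound (F := fun k => miss r k)) => //.
    by apply: bigsetU_measurable.
  by move=> w; rewrite /B -bigcup_seq => -[k _ hk]; exists k.
have -> : (n r)%:R%:E = (\sum_(k < n r) 1%:E)%E :> \bar R.
  by rewrite sumEFin sumr_const card_ord.
by rewrite ge0_sume_distrl//; apply: lee_sum => k _; rewrite mul1e.
Qed.

(** What a labelling of the sample must satisfy for the regression to be
    consistent: its class means behave like those of the latent labels. *)
Definition consistent_labels (c : forall r, Om r -> 'I_(n r) -> 'I_K.+1) :=
  forall (u : R -> R -> R) z, measurable_fun setT (fun ab : R * R => u ab.1 ab.2) ->
  P.-integrable setT (EFin \o (fun w => u (X i w) (Y w))) ->
  onS (fun r w => class_mean (c r w) (fun k => u (x r w k) (y r w k)) z) @ whp Q -->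
    \int[P]_w (u (X i w) (Y w) * label_indic Z z w).

Section statistics.
Variable h : R -> 'I_K.+1 -> R -> R.
Hypothesis mh : measurable_fun setT (fun o : R * 'I_K.+1 * R => h o.1.1 o.1.2 o.2).
Local Notation W r k := (fun w : Om r => h (x r w k) (zl r w k) (y r w k)).
Local Notation W0 := (fun w => h (X i w) (Z w) (Y w)).
Local Notation H r := (fun o : observation R K (p r) =>
  h (tnth o.1.1 (Ordinal (hip r))) o.1.2 o.2).

Let mH r : measurable_fun setT (H r).
Proof.
have mg : measurable_fun setT (fun o : observation R K (p r) =>
    (tnth o.1.1 (Ordinal (hip r)), o.1.2, o.2)).
  apply: measurable_fun_pair => //; apply: measurable_fun_pair.
    apply: (measurableT_comp (measurable_tnth (Ordinal (hip r)))).
    exact: (@measurableT_comp _ _ _ _ _ _ fst).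
  exact: (@measurableT_comp _ _ _ _ _ _ snd).
exact: (measurableT_comp mh mg).
Qed.

Lemma measurable_statistic r k : measurable_fun setT (W r k).
Proof. exact: (measurableT_comp (@mH r) (measurable_obs (S r) k)). Qed.

Lemma statistic_same_law r k : same_law (Q r) (W r k) P W0.
Proof.
have [_ [_ /(_ k) lawS] _] := hdata r.
have := same_law_comp (@mH r) lawS.
by rewrite (_ : H r \o _ = W0)//; apply/funext => w; rewrite /= tnth_mktuple.
Qed.

Lemma statistic_independent r j k : j != k -> independent (Q r) (W r j) (W r k).
Proof.
move=> jk; have [_ [indS _] _] := hdata r.
exact: (independent_comp (@mH r) (@mH r) (mutually_independent_pair indS jk)).
Qed.

Lemma statistic_mean_cvg : P.-integrable setT (EFin \o W0) ->
  onS (fun r w => (n r)%:R^-1 * \sum_(k < n r) W r k w) @ whp Q --> \int[P]_w W0 w.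
Proof.
move=> iW0; apply: (@weak_law_of_large_numbers _ _ R P W0 d Om Q n (fun r k => W r k)) => //.
- exact: measurable_statistic.
- exact: statistic_same_law.
- by move=> r j k; exact: statistic_independent.
Qed.

End statistics.

Let measurable_u (u : R -> R -> R) : measurable_fun setT (fun ab : R * R => u ab.1 ab.2) ->
  measurable_fun setT (fun o : R * 'I_K.+1 * R => u o.1.1 o.2).
Proof.
move=> mu; have mg : measurable_fun setT (fun o : R * 'I_K.+1 * R => (o.1.1, o.2)).
  apply: measurable_fun_pair => //.
  exact: (@measurableT_comp _ _ _ _ _ _ fst).
exact: (measurableT_comp mu mg).
Qed.

Lemma latent_labels_consistent : consistent_labels (fun r w => zl r w).
Proof.
move=> u z mu iu.
pose h a (l : 'I_K.+1) b := u a b * (l == z)%:R.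
apply: (@statistic_mean_cvg h).
  apply: measurable_funM; first exact: measurable_u.
  apply: (@measurableT_comp _ _ _ _ _ _ (fun l : 'I_K.+1 => (l == z)%:R : R)) => //.
  exact: (@measurableT_comp _ _ _ _ _ _ snd).
exact: integrable_label_indic.
Qed.

(** A class mean changes at most by the average of [`|u|] over the misclassified
    observations when the latent labels are replaced. *)
Lemma substitute_labels_consistent (tau : R -> R) :
  (forall r, tail_bound X Z (p r) tau) ->
  misclassification_bound X Z (S0 r) (mucheck r) tau @[r --> \oo] --> 0%E ->
  consistent_labels (fun r w => zh r w).
Proof.
move=> htau bnd0 u z mu iu.
pose h a (l : 'I_K.+1) b := u a b.
have mh := measurable_u mu : measurable_fun setT (fun o : R * 'I_K.+1 * R => h o.1.1 o.1.2 o.2).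
have zlc := @latent_labels_consistent u z mu iu.
have M0 := @misclassified_mean_whp _ _ R P _ iu d Om Q n
  (fun r k w => h (x r w k) (zl r w k) (y r w k)) (fun r k => miss r k) _
  (@measurable_statistic h mh) (@statistic_same_law h mh)
  (fun r k => measurable_misclassified (S0 r) (S r) (mucheck r) (rule r) k)
  (misclassified_near htau) bnd0.
set f := onS _; set g := onS _ in zlc; set b := onS _ in M0.
have fg0 : (f t - g t) @[t --> whp Q] --> (0 : R).
  apply/norm_cvg0P; apply: (squeeze_cvgr _ (cvg_cst 0) M0); apply: nearW => -[r w].
  rewrite normr_ge0 /= /f /g /b /onS/=.
  apply: (le_trans (class_mean_perturb _ _ _ _)).
  rewrite le_eqVlt; apply/orP; left; apply/eqP; congr (_ * _).
  apply: eq_bigr => k _; rewrite indicE; congr (_ * (nat_of_bool _)%:R).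
  by apply/idP/idP; rewrite inE /= => /eqP.
have -> : f = (fun t => (f t - g t) + g t) by apply/funext => t; rewrite subrK.
by rewrite -[X in _ --> X]add0r; exact: cvgD.
Qed.

Let sX := mixture_square_integrable hmix i.

Let sY : square_integrable_rv P Y.
Proof.
have mY : measurable_fun setT Y by exact: measurable_funP.
split => //; apply/integrableP; split.
  by apply/measurable_EFinP; exact: measurable_funX.
under eq_integral do rewrite /= ger0_norm ?sqr_ge0//.
by move: hY; rewrite unlock.
Qed.

Lemma within_cov_cvg (c : forall r, Om r -> 'I_(n r) -> 'I_K.+1) (u v : R -> R -> R) :
  consistent_labels c ->
  measurable_fun setT (fun ab : R * R => u ab.1 ab.2) ->
  measurable_fun setT (fun ab : R * R => v ab.1 ab.2) ->
  square_integrable_rv P (fun w => u (X i w) (Y w)) ->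
  square_integrable_rv P (fun w => v (X i w) (Y w)) ->
  onS (fun r w => (n r)%:R^-1 * within_cov (c r w)
      (fun k => u (x r w k) (y r w k)) (fun k => v (x r w k) (y r w k))) @ whp Q -->
    within_covariance Z (fun w => u (X i w) (Y w)) (fun w => v (X i w) (Y w)).
Proof.
move=> hc mu mv [mU iU2] [mV iV2].
have iU := square_integrable mU iU2; have iV := square_integrable mV iV2.
have iUV := square_integrableM mU mV iU2 iV2.
have cUV := @statistic_mean_cvg (fun a _ b => u a b * v a b)
  (measurable_funM (measurable_u mu) (measurable_u mv)) iUV.
have cU z := hc u z mu iU; have cV z := hc v z mv iV.
have c1 z := hc (fun _ _ => 1) z (measurable_cst _) (integrable_cst P 1).
have p1 z : \int[P]_w (1 * label_indic Z z w) = label_prob Z z.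
  under eq_Rintegral do rewrite mul1r.
  rewrite label_indicE /Rintegral integral_indic//; last exact: measurable_label.
  by rewrite setIT.
have pz0 z : label_prob Z z != 0 by rewrite gt_eqF// label_prob_gt0.
have lim : onS (fun r w => (n r)%:R^-1 * (\sum_(k < n r) u (x r w k) (y r w k) * v (x r w k) (y r w k)) -
    \sum_z (class_mean (c r w) (fun=> 1) z)^-1 *
      (class_mean (c r w) (fun k => u (x r w k) (y r w k)) z *
       class_mean (c r w) (fun k => v (x r w k) (y r w k)) z)) @ whp Q -->
    within_covariance Z (fun w => u (X i w) (Y w)) (fun w => v (X i w) (Y w)).
  apply: cvgB => //; apply: (cvg_big (op := +%R)) => [|z _]; first exact: add_continuous.
  apply: cvgM; last exact: (cvgM (cU z) (cV z)).
  by apply: cvgV; [exact: pz0|rewrite -p1; exact: c1].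
apply: cvg_trans lim; apply: near_eq_cvg.
have n0 : \forall r \near \oo, (0 < n r)%N by exact: (hn (nbhs_infty_gt 0)).
apply: filterS (whp_large Q n0) => -[r w] /= nr0.
by rewrite /onS/= within_cov_class_mean.
Qed.

(** The limit of the denominator is positive: every label has positive
    probability, and for some label the conditional variance of [X i] is
    positive by the lower bound in the model. *)
Lemma estimator_consistent (c : forall r, Om r -> 'I_(n r) -> 'I_K.+1)
    (b : forall r, Om r -> R) :
  consistent_labels c ->
  (forall r, is_adjustment_estimator (Ordinal (hip r)) (S r) (c r) (b r)) ->
  (\forall t \near whp Q, within_var (c (projT1 t) (projT2 t)) (fun k => x (projT1 t) (projT2 t) k) != 0) /\
  onS b @ whp Q --> target X Y Z i.
Proof.
move=> hc hb.
have m1 : measurable_fun setT (fun ab : R * R => ab.1) by exact: measurable_fst.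
have m2 : measurable_fun setT (fun ab : R * R => ab.2) by exact: measurable_snd.
have cxy := within_cov_cvg (u := fun a _ => a) (v := fun _ b => b) hc m1 m2 sX sY.
have cxx := within_cov_cvg (u := fun a _ => a) (v := fun a _ => a) hc m1 m1 sX sX.
have vE : within_covariance Z (X i) (X i) = \sum_z cvar X Z i z * label_prob Z z.
  rewrite -(within_covarianceE hZ)// unlock.
  by rewrite -(Rintegral_label Z (cvar X Z i)).
have cvar0 z : 0 <= cvar X Z i z by rewrite fine_ge0// variance_ge0.
have v0 : 0 < within_covariance Z (X i) (X i).
  rewrite vE; have [_ _ _ [s1 [s2 [s10 _ /(_ i)/andP[+ _]]]] _] := hmix.
  move=> /(lt_le_trans s10) /bigmax_gtP /=.
  rewrite ltxx => -[//|[z _ z0]].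
  rewrite (bigD1 z)//= ltr_wpDr ?mulr_gt0 ?label_prob_gt0//.
  by apply: sumr_ge0 => v _; rewrite mulr_ge0// ltW// label_prob_gt0.
have near0 : \forall t \near whp Q, within_var (c (projT1 t) (projT2 t)) (fun k => x (projT1 t) (projT2 t) k) != 0.
  move/cvgrPdist_lt: (cxx) => /(_ _ v0); apply: filterS => -[r w].
  rewrite /onS/= within_varE; apply: contraTneq => ->.
  by rewrite mulr0 subr0 gtr0_norm// ltxx.
split=> //.
have -> : target X Y Z i = within_covariance Z (X i) Y * (within_covariance Z (X i) (X i))^-1.
  by rewrite -!(within_covarianceE hZ).
have /(_ (whp_filter Q) (whp_filter Q)) lim := cvgM cxy (cvgV (lt0r_neq0 v0) cxx).
apply: cvg_trans lim; apply: near_eq_cvg.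
have n0 : \forall r \near \oo, (0 < n r)%N by exact: (hn (nbhs_infty_gt 0)).
apply: filterS2 near0 (whp_large Q n0) => -[r w] /= wv0 nr0.
rewrite /onS/= hb// within_varE.
have n0' : (n r)%:R != 0 :> R by rewrite pnatr_eq0 -lt0n.
by rewrite invfM invrK mulrACA mulVf// mul1r.
Qed.

End asymptotics.

(** * Rates of recovery *)

Section rates.
Context (R : realType).

Lemma chebyshev_rate (a D2 : nat -> R) (s : R) :
  D2 r / a r @[r --> \oo] --> +oo ->
  a r * (s * (9 / D2 r)) @[r --> \oo] --> 0.
Proof.
move=> Da.
have V0 := (gtr0_cvgV0 (cvgry_gt0 Da)).2 Da.
rewrite (_ : (fun r => _) = (fun r => (s * 9) * (D2 r / a r)^-1)); last first.
  by apply/funext => r; rewrite invf_div; ring.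
rewrite -[X in _ --> X](mulr0 (s * 9)); exact: (cvgM (cvg_cst (s * 9)) (V0 _)).
Qed.

Lemma subgaussian_rate (n : nat -> nat) (D2 : nat -> R) (v : R) : 0 < v ->
  n r @[r --> \oo] --> \oo ->
  D2 r / ln (n r)%:R @[r --> \oo] --> +oo ->
  (n r)%:R * expR (- (2 * v * (9 / D2 r))^-1) @[r --> \oo] --> 0.
Proof.
move=> v0 hn Dl.
have nV : ((n r)%:R^-1 : R) @[r --> \oo] --> 0.
  have ny : ((n r)%:R : R) @[r --> \oo] --> +oo.
    exact: (cvg_comp n (fun k : nat => k%:R : R) hn (@cvgr_idn R)).
  exact: ((gtr0_cvgV0 (cvgry_gt0 ny)).2 ny).
apply: (squeeze_cvgr _ (cvg_cst 0) nV).
have n1 : \forall r \near \oo, (1 < n r)%N by exact: (hn _ (nbhs_infty_gt 1%N)).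
(* The exponent is [D2 r / (18 v)]; beyond the threshold [36 v ln n] the
   exponential is at most [n ^ -2]. *)
move/cvgryPge: Dl => /(_ (36 * v)); apply: filterS2 n1 => r n1 Dr.
have nr0 : 0 < (n r)%:R :> R by rewrite ltr0n ltnW.
rewrite mulr_ge0 ?expR_ge0//= -ler_pdivlMl// -expr2.
have l0 : 0 < ln (n r)%:R :> R by rewrite ln_gt0// ltr1n.
have D0 : 36 * v * ln (n r)%:R <= D2 r by rewrite -ler_pdivlMr.
have D2_gt0 : 0 < D2 r by apply: lt_le_trans D0; rewrite !mulr_gt0.
rewrite -[X in _ <= X ^+ 2](@lnK R) ?posrE ?invr_gt0// lnV ?posrE// -expRM_natl ler_expR.
rewrite mulrN lerN2 invfM invf_div ler_pdivlMl ?mulr_gt0//.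
rewrite ler_pdivlMr//; lra.
Qed.

End rates.

Theorem theorem2 (R : realType)
  (* the population: covariates X_j (j = 0, 1, ...), response Y, label Z *)
  (d0 : measure_display) (Om0 : measurableType d0) (P : probability Om0 R)
  (K : nat) (X : nat -> {RV P >-> R}) (Y : {RV P >-> R})
  (Z : {RV P >-> 'I_K.+1})
  (hY : ('E_P[(fun w => Y w ^+ 2)%R] < +oo)%E)
  (Pk : forall j : nat, R.-pker (R * seqR R)%type ~> R)
  (hPk : regular_conditional_distributions X Y Pk)
  (hmix : mixture_model X Z)
  (i : nat)
  (* the triples (n, m, p) and, for each of them, the data *)
  (n m p : nat -> nat)
  (hn : n r @[r --> \oo] --> \oo)
  (hm : m r @[r --> \oo] --> \oo)
  (hp : p r @[r --> \oo] --> \oo)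
  (hip : forall r, (i < p r)%N)
  (d : nat -> measure_display) (Om : forall r, measurableType (d r))
  (Q : forall r, probability (Om r) R)
  (S0 : forall r, {RV (Q r) >-> (m r).-tuple ((p r).-tuple R)})
  (S : forall r, {RV (Q r) >-> (n r).-tuple (observation R K (p r))})
  (hdata : forall r, sampling X Y Z (S0 r) (S r))
  (* the estimated means, the tie-breaking rule and the two estimators *)
  (mucheck : forall r, {mfun (m r).-tuple ((p r).-tuple R) >->
                             K.+1.-tuple ((p r).-tuple R)})
  (rule : forall r, {mfun ((p r).-tuple R * K.+1.-tuple ((p r).-tuple R))%type
                          >-> 'I_K.+1})
  (hrule : forall r, is_nearest_rule (rule r))
  (bsub : forall r, {RV (Q r) >-> R})
  (hbsub : forall r, is_adjustment_estimator (Ordinal (hip r)) (S r)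
     (substitutes (rule r) (mucheck r) (S0 r) (S r)) (bsub r))
  (bor : forall r, {RV (Q r) >-> R})
  (hbor : forall r, is_adjustment_estimator (Ordinal (hip r)) (S r)
     (obs_z (S r)) (bor r))
  (herr : forall z v, v != z ->
     Q r [set w | 10^-1 < rel_error X Z (mucheck r (S0 r w)) z v]
       @[r --> \oo] --> 0%E) :
  let fast_err := forall z v, v != z ->
    ((n r)%:R%:E *
      Q r [set w | (10^-1 < rel_error X Z (mucheck r (S0 r w)) z v)%R]
       @[r --> \oo] --> 0)%E in
  let case2 :=
    (sep X Z (p r) * ((n r)%:R^-1)%:E @[r --> \oo] --> +oo)%E /\ fast_err in
  let case3 :=
    [/\ exists v, forall j z, subgaussian X Z v j z,
        (sep X Z (p r) * ((ln (n r)%:R)^-1)%:E @[r --> \oo] --> +oo)%E &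
        fast_err] in
  let root_n_close :=
    cvg_in_probability Q
      (fun r w => Num.sqrt (n r)%:R * `|bsub r w - bor r w|) 0 in
  let root_n_normal (b : forall r, {RV (Q r) >-> R}) (s : R) :=
    cvg_in_distribution Q
      (fun r w => Num.sqrt (n r)%:R * (b r w - target X Y Z i))
      (centered_normal s) in
  [/\ cvg_in_probability Q (fun r w => `|bsub r w - bor r w|) 0 /\
      cvg_in_probability Q (fun r w => bsub r w) (target X Y Z i),
      case2 -> root_n_close,
      case3 -> root_n_close &
      case2 \/ case3 -> forall s : R, root_n_normal bor s -> root_n_normal bsub s].

Proof.
move=> fast_err case2 case3 root_n_close root_n_normal.
have [_ _ _ [s1 [s2 [s10 s12 hs]]] _] := hmix.
have s20 : 0 <= s2 by rewrite (le_trans (ltW s10)).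
have cvs j z : cvar X Z j z <= s2.
  by have /andP[_] := hs j; apply: le_trans; exact: le_bigmax.
have chtail r := chebyshev_tail_bound hmix (p := p r) cvs s20.
pose D2 z v r := l2dist (muvec X Z (p r) z) (muvec X Z (p r) v) ^+ 2.
have chtau s : 0 <= s -> 0 <= s2 * s by move=> s0; rewrite mulr_ge0.
have bnd0 : misclassification_bound X Z (S0 r) (mucheck r) (fun s => s2 * s) @[r --> \oo] --> 0%E.
  have lim : (1%:E * misclassification_bound X Z (S0 r) (mucheck r) (fun s => s2 * s)%R)%E
      @[r --> \oo] --> 0%E.
    apply: (misclassification_bound_cvg (a := fun=> 1)) => // z v zv.
      apply: cvg_trans (herr _ _ zv); apply: near_eq_cvg; apply: nearW => r.
      by rewrite mul1e.
    apply: (@chebyshev_rate R (fun=> 1) (D2 z v)).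
    apply: cvg_trans (centers_diverge hmix hp zv); apply: near_eq_cvg; apply: nearW => r.
    by rewrite divr1.
  apply: cvg_trans lim; apply: near_eq_cvg; apply: nearW => r.
  by rewrite mul1e.
have subc := substitute_labels_consistent hmix hn hp hip hdata hrule chtail bnd0.
have orc := latent_labels_consistent hn hip hdata.
have [_ bsub_lim] := estimator_consistent hY hmix hn hdata subc hbsub.
have [or0 bor_lim] := estimator_consistent hY hmix hn hdata orc hbor.
have mb (b : forall r, {RV (Q r) >-> R}) r : measurable_fun setT (b r) by exact: measurable_funP.
have madj r : measurable_fun setT (fun w => `|bsub r w - bor r w|).
  by apply: measurableT_comp => //; apply: measurable_funB; exact: measurable_funP.
(* Once all labels are recovered the two estimators are the same quotient, and
   its denominator does not vanish with high probability. *)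
have agree tau : (forall r, tail_bound X Z (p r) tau) ->
    (forall s, 0 <= s -> 0 <= tau s) -> fast_err ->
    (forall z v, z != v -> (n r)%:R * tau (9 / D2 z v r) @[r --> \oo] --> 0) ->
    \forall t \near whp Q, onS bsub t = onS bor t.
  move=> htau tau0 fe rate.
  have nb := misclassification_bound_cvg (a := fun r => (n r)%:R) (fun=> ler0n _ _) tau0 fe rate.
  have rec := all_labels_recovered hmix hp hdata hrule htau nb.
  apply: filterS2 rec or0 => -[r w] /= zz wv0.
  by rewrite /onS/= hbsub ?hbor ?zz.
have agree23 : case2 \/ case3 -> \forall t \near whp Q, onS bsub t = onS bor t.
  case=> [[hsep fe]|[[v0 sg] hsep fe]].
    apply: (agree _ chtail chtau fe) => z v zv.
    apply: (@chebyshev_rate R (fun r => (n r)%:R) (D2 z v)).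
    apply/cvgryPge => A; move/cvgeyPge: hsep => /(_ A); apply: filterS => r.
    rewrite -lee_fin EFinM => /le_trans; apply.
    by rewrite lee_wpmul2r ?lee_fin ?invr_ge0// sep_le.
  apply: (agree _ (fun r => subgaussian_tail_bound hmix (p := p r) sg)) fe _ => [s _|z v zv].
    exact: expR_ge0.
  apply: (@subgaussian_rate R n (D2 z v)) => //; first by rewrite lt_max ltr01 orbT.
  apply/cvgryPge => A.
  have n1 : \forall r \near \oo, (0 < n r)%N by exact: (hn _ (nbhs_infty_gt 0)).
  move/cvgeyPge: hsep => /(_ A); apply: filterS2 n1 => r n1.
  rewrite -lee_fin EFinM => /le_trans; apply.
  by rewrite lee_wpmul2r ?lee_fin ?invr_ge0 ?ln_ge0 ?ler1n// sep_le.
have close : case2 \/ case3 -> root_n_close.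
  move=> /agree23 eqb; apply: cvg_in_probability_whp.
    by move=> r; apply: measurable_funM.
  apply: cvg_near_cst; apply: filterS eqb => -[r w]; rewrite /onS/= => ->.
  by rewrite subrr normr0 mulr0.
split.
- split; last exact: (cvg_in_probability_whp (mb bsub) bsub_lim).
  apply: (cvg_in_probability_whp madj).
  have /(_ (whp_filter Q)) lim := cvg_norm (cvgB bsub_lim bor_lim).
  by rewrite subrr normr0 in lim; exact: lim.
- by move=> c2; apply: close; left.
- by move=> c3; apply: close; right.
- move=> /agree23 eqb s; apply: cvg_in_distribution_whp.
  + by move=> r; apply: measurable_funM => //; exact: measurable_funB.
  + by move=> r; apply: measurable_funM => //; exact: measurable_funB.
  + by apply: filterS eqb => -[r w]; rewrite /onS/= => ->.
Qed.
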